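(* Let $0<p<1$, $0<q<1$, $\tau>0$, and let $\mathbf{x}_i(t)\in\mathbb{R}^d$ ($1\le i\le N_1$), $\mathbf{y}_j(t)\in\mathbb{R}^d$ ($1\le j\le N_2$), $t\ge0$, solve the linear system $$\dot{\mathbf{x}}_i = \frac{1}{N_1}\sum_{i'\ne i}\psi^+_{i,i'}(t)(\mathbf{x}_{i'}-\mathbf{x}_i)-\frac{1}{N_2}\sum_{j}\psi^-_{i,j}(t)(\mathbf{y}_j-\mathbf{x}_i),\qquad \dot{\mathbf{y}}_j=\frac{1}{N_2}\sum_{j'\ne j}\psi^+_{j,j'}(t)(\mathbf{y}_{j'}-\mathbf{y}_j)-\frac{1}{N_1}\sum_i\psi^-_{j,i}(t)(\mathbf{x}_i-\mathbf{y}_j),$$ where the coefficients are random and constant on each time interval $[k\tau,(k+1)\tau)$, $k=0,1,2,\dots$: $$\psi^+_{i,i'}|_{[k\tau,(k+1)\tau)}=\psi^{+,k}_{i,i'}\sim B(p),\quad \psi^+_{j,j'}|_{[k\tau,(k+1)\tau)}=\psi^{+,k}_{j,j'}\sim B(p),\quad \psi^-_{i,j}|_{[k\tau,(k+1)\tau)}=\psi^{-,k}_{i,j}\sim B(q),$$ independent and symmetric as described in the context. Assume that there exists a constant $\kappa>0$ such that $\frac1\kappa N_1\le N_2\le\kappa N_1$. Then for any fixed $\Lambda>0$, if $N=\min\{N_1,N_2\}$ is sufficiently large (in terms of $\Lambda,\tau,p,q$ and $\kappa$), then with large probability the following holds: if the initial data satisfies $$\tilde\lambda(0):=\frac{\max_i|\hat{\mathbf{x}}_i(0)|^2+\max_j|\hat{\mathbf{y}}_j(0)|^2}{|\bar{\mathbf{x}}(0)-\bar{\mathbf{y}}(0)|^2}\le\Lambda,$$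 then there holds the $L^\infty$ separation at some large time $T=T(\Lambda,\tau,p,q,\kappa)$, in the sense that there exists a constant unit vector $\mathbf{v}$ (independent of $t$) such that $$\max_i\big(\mathbf{x}_i(t)\cdot\mathbf{v}\big)<\min_j\big(\mathbf{y}_j(t)\cdot\mathbf{v}\big)\qquad\text{for all }t\ge T.$$
   Context: Indices $i,i'$ run from $1$ to $N_1$ and $j,j'$ from $1$ to $N_2$; $\sum_{i'\ne i}$ is the sum over $i'$ different from $i$ (similarly $\sum_{j'\ne j}$). The array $\psi^+_{i,i'}$ (interactions within the first group), the array $\psi^+_{j,j'}$ (interactions within the second group), and the array $\psi^-_{i,j}$ (interactions between groups) are three different arrays, with symmetry $\psi^+_{i,i'}=\psi^+_{i',i}$, $\psi^+_{j,j'}=\psi^+_{j',j}$, $\psi^-_{i,j}=\psi^-_{j,i}$. $B(p)$ denotes the Bernoulli distribution: value $1$ with probability $p$ and $0$ with probability $1-p$. Apart from the symmetry constraints, all the random variables $\psi^{+,k}_{i,i'}$, $\psi^{+,k}_{j,j'}$, $\psi^{-,k}_{i,j}$ are mutually independent, for different indices and for different $k$ (the coefficients are resampled at each time $k\tau$). Notation: $\bar{\mathbf{x}}=\frac1{N_1}\sum_i\mathbf{x}_i$, $\bar{\mathbf{y}}=\frac1{N_2}\sum_j\mathbf{y}_j$, $\hat{\mathbf{x}}_i=\mathbf{x}_i-\bar{\mathbf{x}}$, $\hat{\mathbf{y}}_j=\mathbf{y}_j-\bar{\mathbf{y}}$. An event $\mathcal{A}_N$ depending on a large parameter $N$ happens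 with large probability if $\lim_{N\to\infty}P(\mathcal{A}_N)=1$. Here $N=\min\{N_1,N_2\}$, and $\Lambda,\tau,p,q,\kappa$ are fixed as $N\to\infty$. The notation $T=T(\Lambda,\tau,p,q,\kappa)$ means that $T$ depends only on these parameters (in particular not on $N$). *)

(* Defs.v *)
From HB Require Import structures.
From mathcomp Require Import all_boot all_order all_algebra.
From mathcomp Require Import all_classical all_reals all_analysis.
Set Implicit Arguments.
Unset Strict Implicit.
Unset Printing Implicit Defensive.
Import Order.TTheory GRing.Theory Num.Theory.
Import numFieldNormedType.Exports.
Local Open Scope classical_set_scope.
Local Open Scope ring_scope.

(* The library norm on 'rV[R]_d is the sup norm, so the Euclidean structure is
   spelled out here. *)
Definition dot (R : realType) (dim : nat) (u v : 'rV[R]_dim) : R :=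
  \sum_(c < dim) u 0 c * v 0 c.

Definition enorm (R : realType) (dim : nat) (u : 'rV[R]_dim) : R :=
  Num.sqrt (dot u u).

(* For n > 0 the range is finite and nonempty, so sup and inf are attained. *)
Definition fmax (R : realType) (n : nat) (f : 'I_n -> R) : R := sup (range f).
Definition fmin (R : realType) (n : nat) (f : 'I_n -> R) : R := inf (range f).

Definition mean (R : realType) (dim n : nat) (x : 'I_n -> 'rV[R]_dim)
    : 'rV[R]_dim :=
  n%:R^-1 *: \sum_i x i.

Definition deviation (R : realType) (dim n : nat) (x : 'I_n -> 'rV[R]_dim)
    (i : 'I_n) : 'rV[R]_dim :=
  x i - mean x.

(* Meaningful only when mean x <> mean y: division by 0 returns 0. *)
Definition lambda_tilde (R : realType) (dim N1 N2 : nat)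
    (x : 'I_N1 -> 'rV[R]_dim) (y : 'I_N2 -> 'rV[R]_dim) : R :=
  (fmax (fun i => enorm (deviation x i) ^+ 2)
   + fmax (fun j => enorm (deviation y j) ^+ 2))
  / enorm (mean x - mean y) ^+ 2.

(* The coefficients jump at the times k tau, so a solution is a continuous
   curve on [0, +oo[ satisfying the equations inside each time interval.  The
   between-group array is symmetric (psi^-_{i,j} = psi^-_{j,i}) and is
   represented by the single array cxy. *)
Definition solves (R : realType) (dim N1 N2 : nat) (tau : R)
    (cx : nat -> 'I_N1 -> 'I_N1 -> bool)
    (cy : nat -> 'I_N2 -> 'I_N2 -> bool)
    (cxy : nat -> 'I_N1 -> 'I_N2 -> bool)
    (x : 'I_N1 -> R -> 'rV[R]_dim) (y : 'I_N2 -> R -> 'rV[R]_dim) : Prop :=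
  [/\ forall i, {within `[0, +oo[, continuous (x i)},
      forall j, {within `[0, +oo[, continuous (y j)} &
      forall (k : nat) (t : R), k%:R * tau < t < k.+1%:R * tau ->
        (forall i, is_derive t 1 (x i)
          (N1%:R^-1 *: (\sum_(i' < N1 | i' != i)
                          (cx k i i')%:R *: (x i' t - x i t))
           - N2%:R^-1 *: (\sum_(j < N2)
                            (cxy k i j)%:R *: (y j t - x i t))))
        /\
        (forall j, is_derive t 1 (y j)
          (N2%:R^-1 *: (\sum_(j' < N2 | j' != j)
                          (cy k j j')%:R *: (y j' t - y j t))
           - N1%:R^-1 *: (\sum_(i < N1)
                            (cxy k i j)%:R *: (x i t - y j t))))].

(* Mutual independence of the subfamily (X i) for i in D. *)
Definition mutually_independent (R : realType) (d d' : measure_display)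
    (Omega : measurableType d) (S : measurableType d')
    (P : probability Omega R) (I : eqType) (D : set I)
    (X : I -> {RV P >-> S}) : Prop :=
  forall s : seq I, uniq s -> (forall i, i \in s -> D i) ->
  forall B : I -> set S, (forall i, measurable (B i)) ->
    P (\bigcap_(i in [set` s]) (X i @^-1` B i))
    = (\prod_(i <- s) P (X i @^-1` B i))%E.

(* A time step together with a pair inside the first group, inside the second
   group, or across the groups. *)
Definition coef_index (N1 N2 : nat) : Type :=
  (nat * ('I_N1 * 'I_N1 + 'I_N2 * 'I_N2 + 'I_N1 * 'I_N2))%type.

(* By symmetry the free coefficients inside a group are those with i < i'. *)
Definition free_coef (N1 N2 : nat) : set (coef_index N1 N2) :=
  [set e : coef_index N1 N2 | match e.2 with
           | inl (inl (i, i')) => (i < i')%N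
           | inl (inr (j, j')) => (j < j')%N
           | inr _ => True
           end].

Definition coef_family (V : Type) (N1 N2 : nat)
    (psix : nat -> 'I_N1 -> 'I_N1 -> V)
    (psiy : nat -> 'I_N2 -> 'I_N2 -> V)
    (psixy : nat -> 'I_N1 -> 'I_N2 -> V) (e : coef_index N1 N2) : V :=
  match e.2 with
  | inl (inl (i, i')) => psix e.1 i i'
  | inl (inr (j, j')) => psiy e.1 j j'
  | inr (i, j) => psixy e.1 i j
  end.

Definition bernoulli_rv (R : realType) (d : measure_display)
    (Omega : measurableType d) (P : probability Omega R) (p : R)
    (X : {RV P >-> bool}) : Prop :=
  distribution P X = bernoulli_prob p :> (set bool -> \bar R).

Definition random_coefficients (R : realType) (d : measure_display)
    (Omega : measurableType d) (P : probability Omega R) (N1 N2 : nat)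
    (p q : R)
    (psix : nat -> 'I_N1 -> 'I_N1 -> {RV P >-> bool})
    (psiy : nat -> 'I_N2 -> 'I_N2 -> {RV P >-> bool})
    (psixy : nat -> 'I_N1 -> 'I_N2 -> {RV P >-> bool}) : Prop :=
  [/\ (forall k i i' w, psix k i i' w = psix k i' i w)
      /\ (forall k j j' w, psiy k j j' w = psiy k j' j w),
      forall k i i', i != i' -> bernoulli_rv p (psix k i i'),
      forall k j j', j != j' -> bernoulli_rv p (psiy k j j'),
      forall k i j, bernoulli_rv q (psixy k i j) &
      mutually_independent (@free_coef N1 N2) (coef_family psix psiy psixy)].

(* Main.v *)
Require Import Defs.
From mathcomp Require Import all_boot all_order all_algebra.
From mathcomp Require Import all_classical all_reals all_analysis.
From mathcomp Require Import ring lra.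
Set Implicit Arguments.
Unset Strict Implicit.
Unset Printing Implicit Defensive.
Import Order.TTheory GRing.Theory Num.Theory.
Import numFieldNormedType.Exports.
Local Open Scope classical_set_scope.
Local Open Scope ring_scope.

(** The separating direction is [v], the unit vector from the initial mean of the
    first group to that of the second.  The scalar products with [v] solve the
    same linear system, so the problem is one-dimensional.  Measure each agent by
    its signed distance [w a] to the mid-hyperplane, in units of the initial gap
    and positive on the side of its own group.  Then
      [w a' = \sum_b mu b * psi a b * (w b - (+-1) * w a)],
    where [mu] is the inverse size of the group, [psi] the 0-1 array of all
    interactions, and the sign is [+] inside a group and [-] across groups.
    Separation at time [t] follows from [w a t > 0] for all [a].

    Two facts reduce the theorem to finitely many time steps.  The off-diagonal
    coefficients are nonnegative, so positivity at one time [T] persists for all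
    later times whatever the coefficients are ([positive_forever]).  And [T] can be
    a fixed multiple [K tau], chosen from the mean-field flow, where [w a] is
    [expR (2 q t) / 2 + expR ((q - p) t) * r a] with [|r a| <= L]: relatively to
    the gap, the deviations decay like [expR (- (p + q) t)].

    On the [K] first steps the arrays are compared with their averages.  The
    initial data are arbitrary, hence may depend on the arrays, so a bound uniform
    in the data is required: all degrees and codegrees are close to their
    expectations ([quasirandom]).  Codegrees control the quadratic form
    [\sum_a mu a * (\sum_b mu b * psi a b * r b)^2] of a vector centred in each
    group ([quasirandom_quadratic_form]), so that the error made by the mean-field
    flow is small in mean square ([energy_le]).  The error of an individual agent
    need not be small, since its neighbourhood may be correlated with the data, but
    it obeys a scalar equation with bounded forcing, and grows slower than the gap
    ([scaled_error_sup]).  This gives positivity at time [T]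
    ([positive_at_horizon]).

    Degrees and codegrees are sums of independent bounded variables, the codegree
    of two vertices being a sum over third vertices whose two edges are not shared.
    Each concentrates with failure probability exponentially small in the size of
    the smaller group ([chernoff]); as [N1] and [N2] are comparable, there are only
    [O(N^2)] of them on the [K] steps ([quasirandom_whp],
    [failure_probability_small]). *)

(** * Piecewise differentiable functions *)

Section PiecewiseDerivative.
Variables (R : realType) (tau : R).
Hypothesis tau_gt0 : 0 < tau.

(** The second argument takes the index of the time interval because the
    coefficients of the equation jump at the multiples of [tau], where nothing
    but continuity is asked. *)
Definition pw_derive (u : R -> R) (du : nat -> R -> R) : Prop :=
  {within `[0, +oo[, continuous u} /\
  forall (k : nat) (t : R), k%:R * tau < t < k.+1%:R * tau ->
    is_derive t 1 u (du k t).

Lemma pw_derive_eq u v du dv : pw_derive u du -> u =1 v ->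
  (forall k t, k%:R * tau < t < k.+1%:R * tau -> du k t = dv k t) ->
  pw_derive v dv.
Proof.
move=> [cu du1] /funext <- e; split=> // k t kt.
by rewrite -(e _ _ kt); exact: du1.
Qed.

Lemma pw_derive_smooth (u du : R -> R) : (forall t : R, is_derive t 1 u (du t)) ->
  pw_derive u (fun=> du).
Proof.
move=> h; split=> // ; apply: continuous_subspaceT => t.
by apply: differentiable_continuous; apply/derivable1_diffP; case: (h t).
Qed.

Lemma pw_derive_cst c : pw_derive (fun=> c) (fun _ _ => 0).
Proof. by apply: pw_derive_smooth => t; exact: is_derive_cst. Qed.

Lemma pw_derive_expR c : pw_derive (fun t => expR (c * t))
  (fun _ t => c * expR (c * t)).
Proof.
apply: pw_derive_smooth => t.
have h : is_derive t 1 (fun t : R => c * t) c.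
  have := @is_deriveZ R R R id c t 1 1 _.
  by rewrite /GRing.scale /= mulr1; apply; exact: is_derive_id.
by rewrite mulrC; exact: (is_derive1_comp (is_derive_expR _) h).
Qed.

Lemma pw_deriveD u v du dv : pw_derive u du -> pw_derive v dv ->
  pw_derive (fun t => u t + v t) (fun k t => du k t + dv k t).
Proof.
move=> [cu u1] [cv v1]; split.
  by move=> t; exact: (continuousD (cu t) (cv t)).
by move=> k t kt; exact: (is_deriveD (u1 _ _ kt) (v1 _ _ kt)).
Qed.

Lemma pw_deriveM u v du dv : pw_derive u du -> pw_derive v dv ->
  pw_derive (fun t => u t * v t) (fun k t => u t * dv k t + v t * du k t).
Proof.
move=> [cu u1] [cv v1]; split.
  by move=> t; exact: (continuousM (cu t) (cv t)).
by move=> k t kt; exact: (is_deriveM (u1 _ _ kt) (v1 _ _ kt)).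
Qed.

Lemma pw_deriveZ c u du : pw_derive u du ->
  pw_derive (fun t => c * u t) (fun k t => c * du k t).
Proof.
move=> u1; apply: (pw_derive_eq (pw_deriveM (pw_derive_cst c) u1)) => // k t _.
by rewrite mulr0 addr0.
Qed.

Lemma pw_deriveN u du : pw_derive u du ->
  pw_derive (fun t => - u t) (fun k t => - du k t).
Proof.
move=> u1; apply: (pw_derive_eq (pw_deriveZ (-1) u1)) => [t|k t _] /=;
  by rewrite mulN1r.
Qed.

Lemma pw_derive_sum (I : Type) (r : seq I) (P : pred I) (u : I -> R -> R) du :
  (forall i, P i -> pw_derive (u i) (du i)) ->
  pw_derive (fun t => \sum_(i <- r | P i) u i t)
            (fun k t => \sum_(i <- r | P i) du i k t).
Proof.
move=> h; elim: r => [|i r IH].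
  by apply: (pw_derive_eq (pw_derive_cst 0)) => [x|k x _] /=; rewrite big_nil.
have [Pi|Pi] := boolP (P i).
  apply: (pw_derive_eq (pw_deriveD (h i Pi) IH)) => [x|k x _] /=;
  by rewrite big_cons Pi.
by apply: (pw_derive_eq IH) => [x|k x _] /=; rewrite big_cons (negbTE Pi).
Qed.

(** Induction on the number of intervals [[k tau, (k+1) tau]] met by [[s, t]]:
    inside one of them this is the mean value theorem, and continuity glues the
    pieces. *)
Lemma pw_derive_ninc u du s t : pw_derive u du -> 0 <= s -> s <= t ->
  (forall k r, k%:R * tau < r < k.+1%:R * tau -> s < r < t -> du k r <= 0) ->
  u t <= u s.
Proof.
move=> [cu du1] s0 st dle.
suff H n r : s <= r -> r <= t -> r <= n%:R * tau -> u r <= u s.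
  apply: (H (Num.bound (t / tau))) => //.
  rewrite -ler_pdivrMr//; apply: ltW.
  apply: le_lt_trans (archi_boundP _); first by rewrite lexx.
  by rewrite divr_ge0// ?(le_trans s0 st)// ltW.
elim: n r => [|n IH] r sr rt rn.
  by rewrite (_ : r = s)//; apply/eqP; rewrite eq_le sr andbT;
    rewrite mul0r in rn; exact: le_trans s0.
have [rn1|nr] := leP r (n%:R * tau); first exact: IH.
have step a : s <= a -> n%:R * tau <= a -> a <= r -> u r <= u a.
  move=> sa na ar.
  have : r \in `[a, r] by rewrite in_itv /= ar lexx.
  have : a \in `[a, r] by rewrite in_itv /= ar lexx.
  have inn z : z \in `]a, r[ -> n%:R * tau < z < n.+1%:R * tau.
    rewrite in_itv /= => /andP[az zr].
    by rewrite (le_lt_trans na az)/= (lt_le_trans zr rn).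
  move=> ia ir; apply: (@ler0_derive1_le_cc R u a r) => //.
  - by move=> z /inn /du1 [].
  - move=> z zar; rewrite derive1E.
    have /inn zn := zar.
    have := du1 _ _ zn => -[_ ->].
    apply: dle => //; move: zar; rewrite in_itv /= => /andP[az zr].
    by rewrite (le_lt_trans sa az) (lt_le_trans zr rt).
  - apply: continuous_subspaceW cu => z /=; rewrite !in_itv /= andbT.
    by move=> /andP[az _]; rewrite (le_trans s0)// (le_trans sa).
have [ns|sn] := leP (n%:R * tau) s; first exact: step.
apply: (@le_trans _ _ (u (n%:R * tau))); first by apply: step => //; exact: ltW.
by apply: IH => //; [exact: ltW|rewrite (le_trans (ltW nr))].
Qed.

(** Gronwall's inequality: the weight [expR (- c t)] turns the hypothesis into
    a sign condition on the derivative. *)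
Lemma gronwall u du (c B s t : R) : pw_derive u du -> 0 <= s -> s <= t ->
  (forall k r, k%:R * tau < r < k.+1%:R * tau -> s < r < t ->
    du k r <= c * (u r + B)) ->
  u t + B <= (u s + B) * expR (c * (t - s)).
Proof.
move=> u1 s0 st h.
have u2 := pw_deriveM (pw_derive_expR (- c)) (pw_deriveD u1 (pw_derive_cst B)).
have : expR (- c * t) * (u t + B) <= expR (- c * s) * (u s + B).
  apply: (pw_derive_ninc u2) => // k r kr sr /=.
  rewrite addr0.
  have := h k r kr sr; rewrite -subr_le0 => H.
  have e0 := expR_gt0 (- c * r).
  have -> : expR (- c * r) * du k r + (u r + B) * (- c * expR (- c * r))
    = expR (- c * r) * (du k r - c * (u r + B)) by ring.
  by rewrite pmulr_rle0.
have -> : expR (c * (t - s)) = expR (- c * s) / expR (- c * t).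
  by rewrite -expRN -expRD; congr expR; ring.
by rewrite mulrA ler_pdivlMr ?expR_gt0// mulrC [(u s + _) * _]mulrC.
Qed.

End PiecewiseDerivative.

(** * Signed consensus systems *)

Section SignedSystem.
Variables (R : realType) (tau : R) (V : finType) (grp : V -> bool).
Variables (mu : V -> R) (psi : nat -> V -> V -> R).
Hypothesis tau_gt0 : 0 < tau.
Hypothesis mu_ge0 : forall a, 0 <= mu a.
Hypothesis psi01 : forall k a b, 0 <= psi k a b <= 1.

Definition sg (a b : V) : R := if grp a == grp b then 1 else -1.

(** The components [w a] are meant to be signed so that both groups lie on the
    positive side: attraction inside a group and repulsion across the groups then
    both contribute [+ w b], and the sign only remains in the diagonal term. *)
Definition signed_solution (w : V -> R -> R) : Prop :=
  forall a, pw_derive tau (w a)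
    (fun k t => \sum_b mu b * psi k a b * (w b t - sg a b * w a t)).

Lemma mu_psi_ge0 k a b : 0 <= mu b * psi k a b.
Proof. by have /andP[h _] := psi01 k a b; rewrite mulr_ge0. Qed.

Lemma mu_psi_le k a b : mu b * psi k a b <= mu b.
Proof. by have /andP[_ h] := psi01 k a b; rewrite ler_piMr. Qed.

(** While all components are nonnegative, the off-diagonal terms help, so each
    component decays at most exponentially. *)
Lemma positive_until w (s t : R) : signed_solution w -> 0 <= s -> s <= t ->
  (forall a, 0 < w a s) -> (forall r a, s < r < t -> 0 <= w a r) ->
  forall a, 0 < w a t.
Proof.
move=> sol s0 st ws wr a.
have := @gronwall R tau tau_gt0 _ _ (- \sum_b mu b) 0 s t (pw_deriveN (sol a)) s0 st.
rewrite !addr0 => H.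
have {}H : - w a t <= - w a s * expR (- (\sum_b mu b) * (t - s)).
  apply: H => k r _ sr; rewrite addr0 mulrNN -sumrN mulr_suml.
  apply: ler_sum => b _; rewrite -mulrN opprB.
  have h0 := mu_psi_ge0 k a b; have h1 := mu_psi_le k a b.
  have ha := wr r a sr; have hb := wr r b sr.
  apply: (@le_trans _ _ (mu b * psi k a b * w a r)); last exact: ler_wpM2r.
  by apply: ler_wpM2l => //; rewrite /sg; case: ifP => _; lra.
rewrite -oppr_lt0; apply: (le_lt_trans H).
by rewrite mulNr oppr_lt0 mulr_gt0// expR_gt0.
Qed.

Lemma pw_derive_near_gt0 u du (t : R) : pw_derive tau u du -> 0 <= t -> 0 < u t ->
  \forall s \near t, 0 <= s -> 0 < u s.
Proof.
move=> [/subspace_continuousP cu _] t0 ut.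
have tin : `[0, +oo[%classic t by rewrite /= in_itv /= t0.
have h : within `[0, +oo[%classic (nbhs t) [set s | 0 < u s].
  exact: (@cvgr_gt R R _ _ u _ (cu t tin) 0 ut).
apply: filterS (h : nbhs t [set s | `[0, +oo[%classic s -> 0 < u s]).
move=> s hs s0; apply: hs.
by rewrite /= in_itv /= s0.
Qed.

(** Let [inf S] be the first time where some component fails to be positive.
    Everything is nonnegative before it, hence positive at it, hence positive
    shortly after it by continuity: a contradiction.  Only the sign and the
    boundedness of the coefficients enter, so separation at one time lasts
    forever for every realization. *)
Lemma positive_forever w (s t : R) : signed_solution w -> 0 <= s -> s <= t ->
  (forall a, 0 < w a s) -> forall a, 0 < w a t.
Proof.
move=> sol s0 st ws a; rewrite ltNge; apply/negP => wt.
pose S := [set r : R | s <= r /\ exists b, w b r <= 0].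
have St : S t by split => //; exists a.
have lbS : lbound S s by move=> r [].
have hS : has_inf S by split; [exists t|exists s].
have sI : s <= inf S by apply: lb_le_inf => //; exists t.
have I0 : 0 <= inf S by exact: le_trans sI.
have posI : forall b, 0 < w b (inf S).
  apply: (positive_until sol s0 sI ws) => r b /andP[sr rI].
  rewrite leNgt; apply/negP => wr.
  have : S r by split; [exact: ltW|exists b; exact: ltW].
  by move=> /(ge_inf (ex_intro _ s lbS)); rewrite leNgt rI.
have nearI := @filter_forall R V (fun b => [set r | 0 <= r -> 0 < w b r])
  (nbhs (inf S)) (nbhs_filter _) (fun b => pw_derive_near_gt0 (sol b) I0 (posI b)).
have [e /= e0 he] := iffLR (nbhs_ballP _ _) nearI.
have : inf S + e <= inf S.
  apply: lb_le_inf; first by exists t.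
  move=> r Sr; have Ir : inf S <= r by apply: (ge_inf (ex_intro _ s lbS)).
  rewrite leNgt; apply/negP => re.
  case: (Sr) => sr [b]; rewrite leNgt => /negP; apply.
  apply: he; last exact: le_trans sr.
  by rewrite /ball /= distrC ger0_norm ?subr_ge0// ltrBlDl.
by rewrite gerDl leNgt e0.
Qed.

End SignedSystem.

(** * Comparison with the mean-field flow *)

Section MeanField.
Variables (R : realType) (tau : R) (V : finType) (grp : V -> bool).
Variables (mu : V -> R) (psi : nat -> V -> V -> R) (w : V -> R -> R).
Variables (p q L delta : R) (r : V -> R) (K : nat).
Hypothesis tau_gt0 : 0 < tau.
Hypothesis mu_ge0 : forall a, 0 <= mu a.
Hypothesis mu2 : \sum_a mu a = 2.
Hypothesis psi01 : forall k a b, 0 <= psi k a b <= 1.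
Hypothesis sol : signed_solution tau grp mu psi w.
Hypothesis w0 : forall a, w a 0 = 1 / 2 + r a.
Hypothesis rL : forall a, `|r a| <= L.

Let nu := p + q.
Let T := K%:R * tau.
Let M := expR (nu * T).
Let C := 2 / nu ^+ 2 * (2 * L + 1) ^+ 2.

Hypothesis nu_gt0 : 0 < nu.
Hypotheses (M_L : 4 * L < M) (M_C : 16 * C < M).
Hypotheses (delta_ge0 : 0 <= delta) (delta_le1 : delta <= 1).
Hypothesis delta_nu : 4 * delta <= nu / 2.
Hypothesis delta_sup : M * delta + 2 * delta * L <= 1 / 2.
Hypothesis delta_energy :
  delta * (6 * M ^+ 2 + 48 * L ^+ 2) * expR (9 * T) <= 1 / 8.

Definition cross_degree k a := \sum_(b | grp b != grp a) mu b * psi k a b.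
Definition net_degree k a := \sum_b mu b * psi k a b * sg R grp a b.

Hypothesis cross_degree_near : forall k a, (k < K)%N ->
  `|cross_degree k a - q| <= delta.
Hypothesis net_degree_near : forall k a, (k < K)%N ->
  `|net_degree k a - (p - q)| <= 2 * delta.
Hypothesis initial_near : forall k, (k < K)%N ->
  \sum_a mu a * (\sum_b mu b * psi k a b * r b) ^+ 2 <= 8 * delta * L ^+ 2.

(** If every degree took its mean-field value, the solution would be
    [expR (2 q t) / 2 + expR ((q - p) t) * r a].  After multiplication by
    [expR ((p - q) t)] the deviation part becomes the constant [r a], and [y] is
    the error of this approximation. *)
Let y a t := expR ((p - q) * t) * w a t - expR (nu * t) / 2 - r a.
Let theta k a := net_degree k a - (p - q).
Let S k a t := \sum_b mu b * psi k a b * y b t.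
Let f k a t := expR (nu * t) * (cross_degree k a - q)
  + \sum_b mu b * psi k a b * r b - theta k a * r a.
Let E t := \sum_a mu a * y a t ^+ 2.

Let L_ge0 : 0 <= L.
Proof.
have [a _|V0] := pickP (fun _ : V => true); first exact: le_trans (rL a).
by move: mu2; rewrite big_pred0// => /eqP; rewrite eq_sym pnatr_eq0.
Qed.

Lemma degree_split k a :
  \sum_b mu b * psi k a b = net_degree k a + 2 * cross_degree k a.
Proof.
rewrite /net_degree /cross_degree mulr_sumr [X in _ + X]big_mkcond -big_split.
apply: eq_bigr => b _ /=; rewrite /sg eq_sym; case: eqP => _ /=; ring.
Qed.

(** The net degree cancels against the scaling factor up to [theta], and [f]
    collects what the mean-field solution leaves over. *)
Lemma scaled_error_derive a :
  pw_derive tau (y a) (fun k t => S k a t - theta k a * y a t + f k a t).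
Proof.
have h := pw_deriveM (pw_derive_expR tau (p - q)) (sol a).
have h2 := pw_deriveD h (pw_deriveZ (- 2^-1) (pw_derive_expR tau nu)).
have h3 := pw_deriveD h2 (pw_derive_cst tau (- r a)).
apply: (pw_derive_eq h3) => [t|k t _]; first by rewrite /y /=; ring.
rewrite /= addr0 /S /f.
have -> : \sum_b mu b * psi k a b * (w b t - sg R grp a b * w a t) =
  \sum_b mu b * psi k a b * w b t - net_degree k a * w a t.
  by rewrite /net_degree mulr_suml -sumrB; apply: eq_bigr => b _; ring.
have -> : \sum_b mu b * psi k a b * y b t =
   expR ((p - q) * t) * \sum_b mu b * psi k a b * w b t
   - expR (nu * t) / 2 * \sum_b mu b * psi k a b - \sum_b mu b * psi k a b * r b.
  by rewrite !mulr_sumr -!sumrB; apply: eq_bigr => b _; rewrite /y; ring.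
rewrite degree_split /theta /y /nu; by field.
Qed.

(** The weights have total mass [2]; the defect is the weighted variance. *)
Lemma weighted_cauchy_schwarz (x : V -> R) :
  (\sum_a mu a * x a) ^+ 2 <= 2 * \sum_a mu a * x a ^+ 2.
Proof.
set m := \sum_a _.
have : 0 <= \sum_a mu a * (x a - m / 2) ^+ 2.
  by apply: sumr_ge0 => a _; rewrite mulr_ge0// sqr_ge0.
have -> : \sum_a mu a * (x a - m / 2) ^+ 2 =
   \sum_a mu a * x a ^+ 2 - m * \sum_a mu a * x a + (m / 2) ^+ 2 * \sum_a mu a.
  by rewrite !mulr_sumr -sumrB -big_split; apply: eq_bigr => a _ /=; field.
rewrite mu2 -/m; lra.
Qed.

Let l1_error t := \sum_a mu a * `|y a t|.

Lemma l1_error_ge0 t : 0 <= l1_error t.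
Proof. by apply: sumr_ge0 => a _; rewrite mulr_ge0. Qed.

Lemma l1_error_energy t : l1_error t ^+ 2 <= 2 * E t.
Proof.
apply: le_trans (weighted_cauchy_schwarz _) _.
by rewrite ler_pM2l// ler_sum// => a _; rewrite real_normK// num_real.
Qed.

Lemma norm_weighted_sum k a (x : V -> R) :
  `|\sum_b mu b * psi k a b * x b| <= \sum_b mu b * `|x b|.
Proof.
apply: le_trans (ler_norm_sum _ _ _) _; apply: ler_sum => b _.
rewrite normrM ger0_norm ?mu_psi_ge0// ler_wpM2r//.
exact: mu_psi_le.
Qed.

Lemma norm_initial_term k a : `|\sum_b mu b * psi k a b * r b| <= 2 * L.
Proof.
apply: le_trans (norm_weighted_sum _ _ _) _.
rewrite -mu2 mulr_suml; apply: ler_sum => b _; exact: ler_wpM2l.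
Qed.

Lemma before_horizon k t : k%:R * tau < t < k.+1%:R * tau -> t < T -> (k < K)%N.
Proof.
move=> /andP[kt _] tT; have := lt_trans kt tT.
by rewrite /T ltr_pM2r// ltr_nat.
Qed.

Lemma expR_nu_le t : t <= T -> expR (nu * t) <= M.
Proof. by move=> tT; rewrite ler_expR ler_pM2l. Qed.

Lemma cross_term_le k a t : (k < K)%N -> t <= T ->
  `|expR (nu * t) * (cross_degree k a - q)| <= M * delta.
Proof.
move=> kK tT; rewrite normrM ger0_norm ?expR_ge0//.
by apply: ler_pM => //; rewrite ?expR_ge0 ?expR_nu_le ?cross_degree_near.
Qed.

Lemma theta_term_le k a : (k < K)%N -> `|theta k a * r a| <= 2 * delta * L.
Proof. by move=> kK; rewrite normrM ler_pM// net_degree_near. Qed.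

Lemma source_sup k a t : (k < K)%N -> t <= T -> `|f k a t| <= 2 * L + 1 / 2.
Proof.
move=> kK tT; rewrite /f.
have h1 := cross_term_le a kK tT; have h2 := theta_term_le a kK.
have h3 := norm_initial_term k a.
move: h1 h2 h3 delta_sup; rewrite !ler_norml => /andP[? ?] /andP[? ?] /andP[? ?].
move=> ?; apply/andP; split; lra.
Qed.

Lemma sqr_le_of_norm (x c : R) : `|x| <= c -> x ^+ 2 <= c ^+ 2.
Proof.
by move=> h; rewrite -real_normK ?num_real// ler_pXn2r ?nnegrE// (le_trans _ h).
Qed.

Let B := delta * (6 * M ^+ 2 + 48 * L ^+ 2).

(** In mean square the source is of order [delta], although
    [\sum_b mu b * psi k a b * r b] is only bounded for an individual [a]: this
    is where the hypothesis on the quadratic form of [r] enters. *)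
Lemma source_energy k t : (k < K)%N -> t <= T ->
  \sum_a mu a * f k a t ^+ 2 <= B.
Proof.
move=> kK tT.
pose c := M ^+ 2 * delta + 4 * delta * L ^+ 2.
have h a : mu a * f k a t ^+ 2 <=
  3 * (mu a * (\sum_b mu b * psi k a b * r b) ^+ 2) + 3 * c * mu a.
  rewrite (_ : 3 * _ + _ = mu a *
    (3 * (\sum_b mu b * psi k a b * r b) ^+ 2 + 3 * c)); last by ring.
  apply: ler_wpM2l => //.
  have := sqr_le_of_norm (cross_term_le a kK tT).
  have := sqr_le_of_norm (theta_term_le a kK).
  rewrite /f; set x1 := expR _ * _; set x2 := \sum_b _; set x3 := theta _ _ * _.
  move=> h3 h1.
  have d2 : delta ^+ 2 <= delta by rewrite expr2 ler_piMr.
  have h1' : x1 ^+ 2 <= M ^+ 2 * delta.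
    by apply: le_trans h1 _; rewrite exprMn ler_wpM2l ?sqr_ge0.
  have h3' : x3 ^+ 2 <= 4 * delta * L ^+ 2.
    apply: le_trans h3 _; rewrite !exprMn ler_wpM2r ?sqr_ge0//; lra.
  have := sqr_ge0 (x1 - x2); have := sqr_ge0 (x1 + x3); have := sqr_ge0 (x2 + x3).
  rewrite /c; lra.
apply: le_trans (ler_sum _ (fun a _ => h a)) _.
rewrite big_split /= -!mulr_sumr mu2.
have := initial_near kK; rewrite /B /c; lra.
Qed.

(** Gronwall in mean square: by the Cauchy-Schwarz inequality the interaction
    term contributes at most [4 E], and absorbing [theta] and the source brings
    the rate to [9]. *)
Lemma energy_le t : 0 <= t -> t <= T -> E t <= 1 / 8.
Proof.
move=> t0 tT.
have E1 : pw_derive tau E (fun k t =>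
    \sum_a mu a * (2 * y a t * (S k a t - theta k a * y a t + f k a t))).
  apply: pw_derive_sum => a _; apply: pw_deriveZ.
  have h := scaled_error_derive a.
  apply: (pw_derive_eq (pw_deriveM h h)) => [s|k s _] /=; first by rewrite expr2.
  by ring.
have E0 : E 0 = 0.
  by rewrite /E big1// => a _; rewrite /y w0 !mulr0 expR0; ring.
have := @gronwall R tau tau_gt0 _ _ 9 (B / 9) 0 t E1 (lexx _) t0.
rewrite E0 add0r subr0 => H.
have B0 : 0 <= B.
  by rewrite mulr_ge0// addr_ge0// mulr_ge0// sqr_ge0.
have {}H : E t + B / 9 <= B / 9 * expR (9 * t).
  apply: H => k s ks /andP[s0 st].
  have kK := before_horizon ks (lt_le_trans st tT).
  have sT : s <= T by rewrite ltW// (lt_le_trans st tT).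
  have h a : 2 * y a s * (S k a s - theta k a * y a s + f k a s) <=
     2 * l1_error s * `|y a s| + 5 * y a s ^+ 2 + f k a s ^+ 2.
    have hS : y a s * S k a s <= l1_error s * `|y a s|.
      apply: le_trans (ler_norm _) _; rewrite normrM mulrC ler_wpM2r//.
      exact: norm_weighted_sum.
    have ht : - (theta k a * y a s ^+ 2) <= 2 * y a s ^+ 2.
      rewrite -mulNr ler_wpM2r ?sqr_ge0// lerNl.
      have := net_degree_near a kK; rewrite ler_norml => /andP[h _].
      rewrite /theta; move: h delta_le1; lra.
    have := sqr_ge0 (y a s - f k a s); lra.
  apply: le_trans (ler_sum _ (fun a _ => ler_wpM2l (mu_ge0 a) (h a))) _.
  have -> : \sum_a mu a * (2 * l1_error s * `|y a s| + 5 * y a s ^+ 2 + f k a s ^+ 2)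
    = 2 * l1_error s * l1_error s + 5 * E s + \sum_a mu a * f k a s ^+ 2.
    rewrite {2}/l1_error /E !mulr_sumr -!big_split; apply: eq_bigr => a _ /=; ring.
  have := source_energy kK sT; have := l1_error_energy s; lra.
have : B / 9 * expR (9 * t) <= 1 / 8.
  apply: le_trans delta_energy; apply: ler_pM; rewrite ?expR_ge0//.
  - by rewrite divr_ge0.
  - by rewrite ler_pdivrMr// ler_peMr// ler1n.
  - by rewrite ler_expR ler_pM2l.
lra.
Qed.

(** Once the weighted mean of the errors is small, a single component is driven
    by a forcing bounded by [2 L + 1] alone.  Its square may then grow at rate
    [nu], hence [y] itself like [expR (nu t / 2)], which is still negligible
    before the mean-field growth [expR (nu t)]. *)
Lemma scaled_error_sup a : y a T ^+ 2 <= C * M.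
Proof.
have T0 : 0 <= T by rewrite mulr_ge0// ltW.
have h := scaled_error_derive a.
have := @gronwall R tau tau_gt0 _ _ nu C 0 T (pw_deriveM h h) (lexx _) T0.
have -> : y a 0 = 0 by rewrite /y w0 !mulr0 expR0; ring.
rewrite subr0 mulr0 add0r -expr2 -/M => H.
have C0 : 0 <= C by rewrite mulr_ge0 ?sqr_ge0// divr_ge0 ?sqr_ge0.
suff : y a T ^+ 2 + C <= C * M by lra.
apply: H => k s ks /andP[s0 st].
have kK := before_horizon ks st.
have f1 := source_sup a kK (ltW st).
have S1 : `|S k a s| <= 1 / 2.
  apply: (@le_trans _ _ (l1_error s)); first exact: norm_weighted_sum.
  rewrite -(@ler_pXn2r _ 2)// ?nnegrE ?l1_error_ge0//.
  apply: (le_trans (l1_error_energy s)); have := energy_le (ltW s0) (ltW st); lra.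
pose G := S k a s + f k a s.
have G1 : G ^+ 2 <= (2 * L + 1) ^+ 2.
  apply: sqr_le_of_norm; apply: le_trans (ler_normD _ _) _; lra.
have ht : - (theta k a * y a s ^+ 2) <= nu / 4 * y a s ^+ 2.
  rewrite -mulNr ler_wpM2r ?sqr_ge0// lerNl.
  have := net_degree_near a kK; rewrite ler_norml => /andP[h1 _].
  by move: h1 delta_nu; rewrite /theta; lra.
(* Young's inequality with weights [nu / 2] and [2 / nu]. *)
have hG : 2 * (y a s * G) <= nu / 2 * y a s ^+ 2 + 2 / nu * G ^+ 2.
  have := mulr_ge0 (ltW nu_gt0) (sqr_ge0 (y a s - 2 / nu * G)).
  have -> : nu * (y a s - 2 / nu * G) ^+ 2 =
    2 * (nu / 2 * y a s ^+ 2 + 2 / nu * G ^+ 2 - 2 * (y a s * G)).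
    by field; rewrite lt0r_neq0.
  lra.
have hC : nu * C = 2 / nu * (2 * L + 1) ^+ 2.
  by rewrite /C; field; rewrite lt0r_neq0.
have hG2 : 2 / nu * G ^+ 2 <= 2 / nu * (2 * L + 1) ^+ 2.
  by rewrite ler_wpM2l// divr_ge0// ltW.
rewrite [leRHS]mulrDr hC; move: hG ht hG2; rewrite /G; lra.
Qed.

Lemma positive_at_horizon a : 0 < w a T.
Proof.
suff : 0 < expR ((p - q) * T) * w a T by rewrite pmulr_rgt0// expR_gt0.
have -> : expR ((p - q) * T) * w a T = M / 2 + r a + y a T.
  by rewrite /y -/M; ring.
have M0 : 0 < M := expR_gt0 _.
have : `|y a T| < M / 4.
  rewrite -(@ltr_pXn2r _ 2)// ?nnegrE//; last by rewrite divr_ge0// ltW.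
  rewrite real_normK ?num_real//; apply: le_lt_trans (scaled_error_sup a) _.
  have -> : (M / 4) ^+ 2 = M / 16 * M by field.
  rewrite ltr_pM2r//; move: M_C; lra.
have := rL a; rewrite ler_norml ltr_norml => /andP[? ?] /andP[? ?]; move: M_L; lra.
Qed.

End MeanField.

(** * Quasirandom interaction arrays *)

Section Quasirandom.
Variables (R : realType) (V : finType) (grp : V -> bool) (mu : V -> R).
Variables (p q : R).
Hypothesis mu_ge0 : forall a, 0 <= mu a.
Hypothesis mu1 : forall g, \sum_(b | grp b == g) mu b = 1.

Definition edge_prob (a b : V) : R := if grp a == grp b then p else q.

(** Quasirandomness in the sense of graph theory: degrees and codegrees are
    those of the averaged array.  Codegrees of two distinct vertices control the
    array as an operator on mean squares. *)
Definition quasirandom (delta : R) (psi : V -> V -> R) : Prop :=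
  (forall a g, `|\sum_(b | grp b == g) mu b * (psi a b - edge_prob a b)| <= delta)
  /\ (forall b b', b != b' ->
    `|\sum_a mu a * (psi a b * psi a b' - edge_prob a b * edge_prob a b')|
      <= delta).

Lemma sum_groups (F : V -> R) a :
  \sum_b F b = \sum_(b | grp b == grp a) F b + \sum_(b | grp b == ~~ grp a) F b.
Proof.
rewrite (bigID (fun b => grp b == grp a)) /=; congr (_ + _).
by apply: eq_bigl => b; case: (grp b) (grp a) => -[].
Qed.

Lemma mu_total : V -> \sum_b mu b = 2.
Proof. by move=> a; rewrite (sum_groups _ a) !mu1; ring. Qed.

Variables (delta : R) (psi : nat -> V -> V -> R) (k : nat).
Hypothesis qr : quasirandom delta (psi k).

Lemma group_degree_near a g :
  `|\sum_(b | grp b == g) mu b * psi k a b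
    - (if grp a == g then p else q)| <= delta.
Proof.
have [deg _] := qr.
have := deg a g; congr (`|_| <= _).
rewrite -[X in _ - X]mul1r -(mu1 g) mulr_suml -sumrB.
by apply: eq_bigr => b /eqP <-; rewrite mulrBr.
Qed.

Lemma quasirandom_cross_degree a : `|cross_degree grp mu psi k a - q| <= delta.
Proof.
have := group_degree_near a (~~ grp a).
rewrite (_ : (grp a == ~~ grp a) = false); last by case: (grp a).
rewrite /cross_degree; congr (`|_ - _| <= _).
by apply: eq_bigl => b; case: (grp b) (grp a) => -[].
Qed.

Lemma quasirandom_net_degree a :
  `|net_degree grp mu psi k a - (p - q)| <= 2 * delta.
Proof.
have := group_degree_near a (grp a); have := group_degree_near a (~~ grp a).
rewrite eqxx (_ : (grp a == ~~ grp a) = false); last by case: (grp a).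
rewrite /net_degree (sum_groups _ a).
rewrite [X in `|X + _ - _|](_ : _ = \sum_(b | grp b == grp a) mu b * psi k a b).
  2: by apply: eq_bigr => b /eqP bg; rewrite /sg bg eqxx mulr1.
rewrite [X in `|_ + X - _|](_ : _ = - \sum_(b | grp b == ~~ grp a) mu b * psi k a b).
  2: by rewrite -sumrN; apply: eq_bigr => b /eqP bg; rewrite /sg bg;
     case: (grp a); rewrite mulrN1.
rewrite !ler_norml => /andP[? ?] /andP[? ?]; apply/andP; split; lra.
Qed.

Variables (r : V -> R) (L : R).
Hypotheses (p01 : 0 <= p <= 1) (q01 : 0 <= q <= 1).
Hypothesis psi01 : forall k a b, 0 <= psi k a b <= 1.
Hypothesis mu_small : forall b, mu b <= delta.
Hypothesis rL : forall a, `|r a| <= L.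
Hypothesis r_centred : forall g, \sum_(b | grp b == g) mu b * r b = 0.

Lemma edge_prob01 a b : 0 <= edge_prob a b <= 1.
Proof. by rewrite /edge_prob; case: ifP. Qed.

(** The averaged array only depends on the groups, so it kills vectors centred
    in each group. *)
Lemma mean_field_operator_centred a : \sum_b mu b * edge_prob a b * r b = 0.
Proof.
rewrite (sum_groups _ a).
have same b : grp b == grp a -> mu b * edge_prob a b * r b = p * (mu b * r b).
  by move=> /eqP bg; rewrite /edge_prob bg eqxx; ring.
have cross b : grp b == ~~ grp a ->
    mu b * edge_prob a b * r b = q * (mu b * r b).
  by move=> /eqP bg; rewrite /edge_prob bg; case: (grp a) => /=; ring.
rewrite (eq_bigr _ same) (eq_bigr _ cross).
by rewrite -!mulr_sumr !r_centred !mulr0 addr0.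
Qed.

Lemma quadratic_form_expand (u : V -> V -> R) :
  \sum_a mu a * (\sum_b mu b * u a b * r b) ^+ 2 =
  \sum_b \sum_b' mu b * mu b' * (r b * r b') * \sum_a mu a * (u a b * u a b').
Proof.
transitivity (\sum_a \sum_b \sum_b'
    mu b * mu b' * (r b * r b') * (mu a * (u a b * u a b'))).
  apply: eq_bigr => a _; rewrite expr2 mulr_suml mulr_sumr.
  apply: eq_bigr => b _; rewrite !mulr_sumr; apply: eq_bigr => b' _; ring.
rewrite exchange_big /=; apply: eq_bigr => b _.
rewrite exchange_big /=; apply: eq_bigr => b' _.
by rewrite mulr_sumr.
Qed.

(** Expanding the square turns the quadratic form into codegrees.  Replacing
    each codegree by its mean-field value gives zero, because the vector is
    centred in each group; off the diagonal the replacement costs [delta], and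
    the diagonal carries little mass. *)
Lemma quasirandom_quadratic_form :
  \sum_a mu a * (\sum_b mu b * psi k a b * r b) ^+ 2 <= 8 * delta * L ^+ 2.
Proof.
have [a0 _|V0] := pickP (fun _ : V => true); last first.
  have [z _|z] := pickP (fun b => grp b == true); first by have := V0 z.
  by have := mu1 true; rewrite (eq_bigl _ _ z) big_pred0// => /eqP;
     rewrite eq_sym oner_eq0.
have L0 : 0 <= L := le_trans (normr_ge0 _) (rL a0).
have d0 : 0 <= delta := le_trans (mu_ge0 a0) (mu_small a0).
have mu2 := mu_total a0.
pose G b b' := \sum_a mu a * (psi k a b * psi k a b' - edge_prob a b * edge_prob a b').
have -> : \sum_a mu a * (\sum_b mu b * psi k a b * r b) ^+ 2 =
    \sum_b \sum_b' mu b * mu b' * (r b * r b') * G b b'.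
  have Q0 : \sum_a mu a * (\sum_b mu b * edge_prob a b * r b) ^+ 2 = 0.
    by apply: big1 => a _; rewrite mean_field_operator_centred expr0n mulr0.
  rewrite -[LHS]subr0 -[X in _ - X = _]Q0 !quadratic_form_expand -sumrB; apply: eq_bigr => b _.
  rewrite -sumrB; apply: eq_bigr => b' _; rewrite -mulrBr /G; congr (_ * _).
  by rewrite -sumrB; apply: eq_bigr => a _; ring.
have Gle b b' : `|G b b'| <= delta + 2 * (b == b')%:R.
  have [<-|bb'] := eqVneq b b'; last first.
    by rewrite mulr0 addr0; have [_] := qr; apply.
  rewrite mulr1; apply: (@le_trans _ _ 2); last by rewrite lerDr.
  apply: le_trans (ler_norm_sum _ _ _) _; rewrite -mu2; apply: ler_sum => a _.
  rewrite normrM ger0_norm// ler_piMr//.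
  have /andP[x0 x1] := psi01 k a b; have /andP[e0 e1] := edge_prob01 a b.
  have xx0 := mulr_ge0 x0 x0; have ee0 := mulr_ge0 e0 e0.
  have xx1 := mulr_ile1 x0 x0 x1 x1; have ee1 := mulr_ile1 e0 e0 e1 e1.
  by rewrite ler_norml; apply/andP; split; lra.
apply: (@le_trans _ _ (\sum_b \sum_b' mu b * mu b' * L ^+ 2 * (delta + 2 * (b == b')%:R))).
  apply: ler_sum => b _; apply: ler_sum => b' _.
  apply: le_trans (ler_norm _) _; rewrite normrM; apply: ler_pM => //.
  rewrite normrM ger0_norm ?mulr_ge0// ler_wpM2l ?mulr_ge0//.
  by rewrite normrM expr2; apply: ler_pM.
have inner b : \sum_b' mu b * mu b' * L ^+ 2 * (delta + 2 * (b == b')%:R) =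
    mu b * L ^+ 2 * (2 * delta + 2 * mu b).
  rewrite [in RHS](_ : 2 * delta = \sum_b' mu b' * delta);
    last by rewrite -mulr_suml mu2.
  have -> : 2 * mu b = \sum_b' mu b' * (2 * (b == b')%:R).
    rewrite (bigD1 b) //= eqxx mulr1 big1 ?addr0; first by rewrite mulrC.
    by move=> c cb; rewrite eq_sym (negbTE cb) !mulr0.
  by rewrite -big_split mulr_sumr; apply: eq_bigr => c _ /=; ring.
rewrite (eq_bigr _ (fun b _ => inner b)).
have -> : 8 * delta * L ^+ 2 = \sum_b mu b * L ^+ 2 * (4 * delta).
  by rewrite -!mulr_suml mu2; ring.
apply: ler_sum => b _; apply: ler_wpM2l; first by rewrite mulr_ge0 ?sqr_ge0.
have := mu_small b; lra.
Qed.

End Quasirandom.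

(** * Concentration of independent sums *)

(** [expR u] is the inverse of [expR (- u) >= 1 - u], and
    [1 / (1 - u) <= 1 + u + 2 u^2] amounts to [0 <= u^2 (1 - 2 u)]. *)
Lemma expR_le_quadratic (R : realType) (u : R) :
  u <= 1 / 2 -> expR u <= 1 + u + 2 * u ^+ 2.
Proof.
move=> u2; have h := expR_ge1Dx (- u).
have u1 : 0 < 1 - u by lra.
rewrite -[u in expR u]opprK expRN -div1r.
apply: (@le_trans _ _ (1 / (1 - u))).
  by rewrite ler_pM2l// lef_pV2 ?posrE ?expR_gt0.
rewrite ler_pdivrMr//.
have : 0 <= u ^+ 2 * (1 - 2 * u) by rewrite mulr_ge0 ?sqr_ge0//; lra.
lra.
Qed.

Section UnionBound.
Variables (R : realType) (d : measure_display) (Omega : measurableType d).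
Variable P : probability Omega R.

Lemma union_bound (I : Type) (s : seq I) (Q : pred I) (F : I -> set Omega)
    (b : I -> R) : (forall i, measurable (F i)) ->
  (forall i, Q i -> (P (F i) <= (b i)%:E)%E) ->
  (P (\big[setU/set0]_(i <- s | Q i) F i) <= (\sum_(i <- s | Q i) b i)%:E)%E.
Proof.
move=> mF PF; elim: s => [|i s IH]; first by rewrite !big_nil measure0.
rewrite !big_cons; case: ifP => // Qi.
apply: le_trans (measureU2 _ _ _) _ => //; first exact: bigsetU_measurable.
by rewrite EFinD leeD// PF.
Qed.

End UnionBound.

Section Chernoff.
Variables (R : realType) (d : measure_display) (Omega : measurableType d).
Variables (P : probability Omega R) (I Z : finType) (D : pred I) (z0 : Z).
Variables (Y : I -> Omega -> Z) (wt xi : I -> Z -> R).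
Hypothesis wt_ge0 : forall i z, 0 <= wt i z.
Hypothesis wt1 : forall i, D i -> \sum_z wt i z = 1.
Hypothesis xi_centred : forall i, D i -> \sum_z wt i z * xi i z = 0.
Hypothesis xi_le1 : forall i z, `|xi i z| <= 1.

Let cell (c : {ffun I -> Z}) := [set om | forall i, D i -> Y i om = c i].

Hypothesis cell_measurable : forall c, measurable (cell c).
Hypothesis cell_le : forall c, (P (cell c) <= (\prod_(i | D i) wt i (c i))%:E)%E.

Lemma moment_generating_le i (x : R) : D i -> `|x| <= 1 / 2 ->
  \sum_z wt i z * expR (x * xi i z) <= expR (2 * x ^+ 2).
Proof.
move=> Di x2; apply: le_trans (expR_ge1Dx _).
have h z : wt i z * expR (x * xi i z) <=
    (1 + 2 * x ^+ 2) * wt i z + x * (wt i z * xi i z).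
  rewrite (_ : _ + _ = wt i z * (1 + x * xi i z + 2 * x ^+ 2)); last by ring.
  apply: ler_wpM2l => //.
  have xz : `|x * xi i z| <= 1 / 2.
    by rewrite normrM -[leRHS]mulr1; apply: ler_pM.
  apply: le_trans (expR_le_quadratic (le_trans (ler_norm _) xz)) _.
  rewrite lerD2l ler_pM2l// exprMn ler_piMr ?sqr_ge0//.
  by rewrite -real_normK ?num_real// exprn_ile1.
apply: le_trans (ler_sum _ (fun z _ => h z)) _.
by rewrite big_split /= -!mulr_sumr wt1// xi_centred// mulr0 addr0 mulr1.
Qed.

Variables (lam : I -> R) (eta : R).
Hypothesis eta_gt0 : 0 < eta.
Hypothesis lam_le : forall i, `|lam i| <= eta.
Hypothesis lam_total : \sum_(i | D i) `|lam i| <= 2.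

(** The event is a union of cells, so that its probability is a finite sum
    over configurations; weighting each configuration by
    [expR (theta (sum - delta)) >= 1] factorizes that sum. The choice
    [theta = delta / (8 eta)] is the optimal one for the resulting bound
    [expR (4 eta theta^2 - theta delta)]. *)
Lemma chernoff_upper (delta : R) : 0 < delta -> delta <= 4 ->
  exists Bad : set Omega, [/\ measurable Bad,
    (P Bad <= (expR (- (delta ^+ 2 / (16 * eta))))%:E)%E &
    forall om, ~ Bad om -> \sum_(i | D i) lam i * xi i (Y i om) < delta].
Proof.
move=> d0 d4.
pose val (c : {ffun I -> Z}) := \sum_(i | D i) lam i * xi i (c i).
pose Q c := (c \in pffun_on z0 D predT) && (delta <= val c).
exists (\big[setU/set0]_(c | Q c) cell c); split.
- exact: bigsetU_measurable.
- apply: le_trans (union_bound _ _ (fun c _ => cell_le c)) _ => //.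
  rewrite lee_fin.
  pose theta := delta / (8 * eta).
  have th0 : 0 <= theta by rewrite divr_ge0 ?ltW// mulr_gt0.
  have th2 : 0 <= 2 * theta ^+ 2 by apply: mulr_ge0; rewrite ?sqr_ge0.
  have e0 : eta != 0 by rewrite lt0r_neq0.
  apply: (@le_trans _ _ (\sum_(c in pffun_on z0 D predT)
     expR (- (theta * delta)) *
     \prod_(i | D i) (wt i (c i) * expR (theta * lam i * xi i (c i))))).
    rewrite [leLHS]big_mkcondr /=; apply: ler_sum => c _; case: ifP => [dc|_].
      rewrite big_split /= -expR_sum mulrCA -expRD ler_peMr ?prodr_ge0//.
      rewrite -[leLHS]expR0 ler_expR.
      have -> : \sum_(i | D i) theta * lam i * xi i (c i) = theta * val c.
        by rewrite /val mulr_sumr; apply: eq_bigr => i _; rewrite mulrA.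
      by rewrite addrC subr_ge0 ler_wpM2l.
    by rewrite mulr_ge0 ?expR_ge0// prodr_ge0// => i _; rewrite mulr_ge0 ?expR_ge0.
  rewrite -mulr_sumr.
  rewrite -(big_distr_big z0 D predT
    (fun i z => wt i z * expR (theta * lam i * xi i z))).
  apply: (@le_trans _ _ (expR (- (theta * delta)) *
      \prod_(i | D i) expR (2 * (theta * lam i) ^+ 2))).
    rewrite ler_wpM2l ?expR_ge0//; apply: ler_prod => i Di; apply/andP; split.
      by apply: sumr_ge0 => z _; rewrite mulr_ge0 ?expR_ge0.
    apply: moment_generating_le => //.
    rewrite normrM ger0_norm//.
    apply: (@le_trans _ _ (theta * eta)); first by rewrite ler_wpM2l.
    rewrite (_ : theta * eta = delta / 8); last by rewrite /theta; field.
    lra.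
  rewrite -expR_sum -expRD ler_expR.
  apply: (@le_trans _ _ (- (theta * delta) + 2 * theta ^+ 2 * (eta * 2))).
    rewrite lerD2l.
    apply: (@le_trans _ _ (2 * theta ^+ 2 * \sum_(i | D i) eta * `|lam i|)).
      rewrite mulr_sumr; apply: ler_sum => i _.
      rewrite exprMn [leLHS]mulrA; apply: ler_wpM2l => //.
      by rewrite -real_normK ?num_real// expr2 ler_wpM2r.
    rewrite -mulr_sumr; apply: ler_wpM2l => //.
    by rewrite ler_wpM2l// ltW.
  by rewrite le_eqVlt; apply/orP; left; apply/eqP; rewrite /theta; field.
- move=> om nBad; rewrite ltNge; apply/negP => dle; apply: nBad.
  (* Cells are indexed by configurations equal to [z0] outside [D]. *)
  pose c := [ffun i => if D i then Y i om else z0].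
  have cell_c : cell c om by move=> i Di; rewrite ffunE Di.
  have Qc : Q c.
    apply/andP; split.
      apply/pffun_onP; split => //; apply/supportP => i Di.
      by rewrite ffunE; move: Di; rewrite unfold_in => /negbTE ->.
    rewrite /val (eq_bigr (fun i => lam i * xi i (Y i om)))// => i Di.
    by rewrite ffunE Di.
  by rewrite (bigD1 c)//; left.
Qed.

End Chernoff.

Section TwoSidedChernoff.
Variables (R : realType) (d : measure_display) (Omega : measurableType d).
Variables (P : probability Omega R) (I Z : finType) (D : pred I) (z0 : Z).
Variables (Y : I -> Omega -> Z) (wt xi : I -> Z -> R).

Lemma chernoff (lam : I -> R) (eta delta : R) :
  (forall i z, 0 <= wt i z) ->
  (forall i, D i -> \sum_z wt i z = 1) ->
  (forall i, D i -> \sum_z wt i z * xi i z = 0) ->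
  (forall i z, `|xi i z| <= 1) ->
  (forall c : {ffun I -> Z},
    measurable [set om | forall i, D i -> Y i om = c i]) ->
  (forall c : {ffun I -> Z}, (P [set om | forall i, D i -> Y i om = c i]
    <= (\prod_(i | D i) wt i (c i))%:E)%E) ->
  0 < eta -> (forall i, `|lam i| <= eta) -> \sum_(i | D i) `|lam i| <= 2 ->
  0 < delta -> delta <= 4 ->
  exists Bad : set Omega, [/\ measurable Bad,
    (P Bad <= (2 * expR (- (delta ^+ 2 / (16 * eta))))%:E)%E &
    forall om, ~ Bad om -> `|\sum_(i | D i) lam i * xi i (Y i om)| <= delta].
Proof.
move=> h1 h2 h3 h4 h5 h6 h7 h8 h9 d0 d4.
have [B1 [m1 P1 b1]] := chernoff_upper z0 h1 h2 h3 h4 h5 h6 h7 h8 h9 d0 d4.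
have h8' i : `|- lam i| <= eta by rewrite normrN.
have h9' : \sum_(i | D i) `|- lam i| <= 2.
  by rewrite (eq_bigr (fun i => `|lam i|))// => i _; rewrite normrN.
have [B2 [m2 P2 b2]] := chernoff_upper z0 h1 h2 h3 h4 h5 h6 h7 h8' h9' d0 d4.
exists (B1 `|` B2); split; first exact: measurableU.
  apply: le_trans (measureU2 _ _ _) _ => //.
  by rewrite mulr_natl mulr2n EFinD leeD.
move=> om /not_orP[/b1 l1 /b2 l2]; rewrite ler_norml; apply/andP; split; last exact: ltW.
move: l2; rewrite (eq_bigr (fun i => - (lam i * xi i (Y i om)))); last first.
  by move=> i _; rewrite mulNr.
by rewrite sumrN ltrNl => /ltW.
Qed.

End TwoSidedChernoff.

(** * The random interaction arrays are quasirandom *)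

Section RandomArrays.
Variables (R : realType) (d : measure_display) (Omega : measurableType d).
Variables (P : probability Omega R) (N1 N2 : nat) (p q : R).
Variables (psix : nat -> 'I_N1 -> 'I_N1 -> {RV P >-> bool}).
Variables (psiy : nat -> 'I_N2 -> 'I_N2 -> {RV P >-> bool}).
Variables (psixy : nat -> 'I_N1 -> 'I_N2 -> {RV P >-> bool}).
Hypotheses (p01 : 0 <= p <= 1) (q01 : 0 <= q <= 1).
Hypothesis rand : random_coefficients p q psix psiy psixy.

Let V := ('I_N1 + 'I_N2)%type.

Definition in_first (a : V) : bool := if a is inl _ then true else false.

(** Unordered pairs are represented by their increasing ordering, which makes
    every edge between distinct vertices one of the free coefficients. *)
Definition edge (k : nat) (a b : V) : coef_index N1 N2 :=
  (k, match a, b with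
      | inl i, inl i' => inl (inl (if (i < i')%N then (i, i') else (i', i)))
      | inr j, inr j' => inl (inr (if (j < j')%N then (j, j') else (j', j)))
      | inl i, inr j => inr (i, j)
      | inr j, inl i => inr (i, j)
      end).

Let X := coef_family psix psiy psixy.
Let pr (a b : V) : R := edge_prob in_first p q a b.

Definition interaction (om : Omega) (k : nat) (a b : V) : R :=
  ((a != b) && X (edge k a b) om)%:R.

Lemma edge_free k a b : a != b -> free_coef (edge k a b).
Proof.
case: a b => i [] j //= ab; rewrite /free_coef /edge /=;
  have := ab; rewrite (inj_eq inl_inj, inj_eq inr_inj) -val_eqE /= neq_ltn;
  by case: ltngtP.
Qed.

Lemma edge_inj k a b a' b' : edge k a b = edge k a' b' ->
  (a = a' /\ b = b') \/ (a = b' /\ b = a').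
Proof.
case: a b a' b' => i [] j [] i' [] j' //=; rewrite /edge.
- by case: ifP; case: ifP => _ _ [-> ->]; [left|right|right|left].
- by case=> -> ->; left.
- by case=> -> ->; right.
- by case=> -> ->; right.
- by case=> -> ->; left.
- by case: ifP; case: ifP => _ _ [-> ->]; [left|right|right|left].
Qed.

Lemma edge_law k a b z : a != b ->
  P (X (edge k a b) @^-1` [set z]) = (if z then pr a b else 1 - pr a b)%:E.
Proof.
move=> ab; have [_ hx hy hxy _] := rand.
have main (Y : {RV P >-> bool}) (s : R) : 0 <= s <= 1 -> bernoulli_rv s Y ->
    P (Y @^-1` [set z]) = (if z then s else 1 - s)%:E.
  move=> s01 /(congr1 (fun m => m [set z])).
  rewrite /distribution /pushforward /= => ->.
  rewrite bernoulli_probE// !diracE; case: z.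
    rewrite mem_set// memNset//.
    by rewrite mule1 mule0 adde0.
  rewrite memNset//.
  by rewrite mem_set// mule1 mule0 add0e.
case: a b ab => i [] j ab; rewrite /pr /edge_prob /X /coef_family /edge /=.
- by apply: main => //; case: ifP => _; apply: hx => //; rewrite eq_sym.
- by apply: main.
- by apply: main.
- by apply: main => //; case: ifP => _; apply: hy => //; rewrite eq_sym.
Qed.

Lemma preimage_measurable e (B : set bool) : measurable (X e @^-1` B).
Proof. exact: measurable_funPTI. Qed.

Lemma eprod_le (J : eqType) (s : seq J) (F : J -> \bar R) (b : J -> R) :
  (forall j, j \in s -> (0 <= F j)%E) ->
  (forall j, j \in s -> (F j <= (b j)%:E)%E) ->
  (\prod_(j <- s) F j <= (\prod_(j <- s) b j)%:E)%E.
Proof.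
elim: s => [|j s IH] F0 Fb; first by rewrite !big_nil.
rewrite !big_cons EFinM.
have js : j \in j :: s by rewrite inE eqxx.
apply: lee_pmul; [exact: F0| |exact: Fb|].
  rewrite big_seq; apply: prode_ge0 => i si; apply: F0; rewrite inE si orbT //.
by apply: IH => i si; [apply: F0|apply: Fb]; rewrite inE si orbT.
Qed.

Lemma joint_measurable (J : eqType) (s : seq J) (eds : J -> coef_index N1 N2)
    (c : J -> bool) :
  measurable [set om | forall j, j \in s -> X (eds j) om = c j].
Proof.
rewrite (_ : [set _ | _] =
  \bigcap_(j in [set` s]) (X (eds j) @^-1` [set c j])); last by [].
by apply: fin_bigcap_measurable => // j _; exact: preimage_measurable.
Qed.

(** The value sets required by independence are indexed by edges; the set
    attached to an edge imposes every constraint that falls on it, which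
    avoids inverting the map from indices to edges. *)
Lemma joint_le (J : eqType) (s : seq J) (eds : J -> coef_index N1 N2)
    (c : J -> bool) (b : J -> R) :
  uniq (map eds s) -> (forall j, j \in s -> free_coef (eds j)) ->
  (forall j, j \in s -> (P (X (eds j) @^-1` [set c j]) <= (b j)%:E)%E) ->
  (P [set om | forall j, j \in s -> X (eds j) om = c j]
    <= (\prod_(j <- s) b j)%:E)%E.
Proof.
move=> us fs ps; have [_ _ _ _ indep] := rand.
pose B e := [set z : bool | forall j, j \in s -> eds j = e -> z = c j].
have fs' e : e \in map eds s -> free_coef e.
  by case/mapP => j js ->; exact: fs.
have mB e : measurable (B e) by [].
have := indep _ us fs' B mB; rewrite big_map => PB.
apply: (@le_trans _ _ (\prod_(j <- s) P (X (eds j) @^-1` B (eds j)))%E).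
  rewrite -PB; apply: le_measure; rewrite ?inE.
  - exact: joint_measurable.
  - by apply: fin_bigcap_measurable => // e _; exact: preimage_measurable.
  - by move=> om h e _ j js <-; exact: h.
apply: eprod_le => j js; first exact: measure_ge0.
apply: le_trans (ps j js); apply: le_measure; rewrite ?inE.
- exact: preimage_measurable.
- exact: preimage_measurable.
- by move=> om h; exact: h.
Qed.

Variables (mu : V -> R) (eta delta : R).
Hypothesis mu_ge0 : forall a, 0 <= mu a.
Hypothesis mu_le : forall a, mu a <= eta.
Hypothesis mu2 : \sum_a mu a <= 2.
Hypotheses (eta_gt0 : 0 < eta) (delta_gt0 : 0 < delta) (delta_le4 : delta <= 4).

Let tail := 2 * expR (- (delta ^+ 2 / (16 * eta))).
Let law (a b : V) (z : bool) : R := if z then pr a b else 1 - pr a b.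

Lemma pr01 a b : 0 <= pr a b <= 1.
Proof. exact: edge_prob01. Qed.

Lemma law_ge0 a b z : 0 <= law a b z.
Proof. by have /andP[? ?] := pr01 a b; rewrite /law; case: z; rewrite ?subr_ge0. Qed.

Lemma weight_total (D : pred V) (lam : V -> R) : (forall b, `|lam b| <= mu b) ->
  \sum_(b | D b) `|lam b| <= 2.
Proof.
move=> lm; apply: le_trans mu2; rewrite big_mkcond; apply: ler_sum => b _.
by case: ifP => _.
Qed.

(** The vertex [a] has no edge to itself; its missing term costs at most [eta],
    and the others are independent. *)
Lemma degree_concentrated k a (lam : V -> R) : (forall b, `|lam b| <= mu b) ->
  exists Bad : set Omega, [/\ measurable Bad, (P Bad <= tail%:E)%E &
    forall om, ~ Bad om ->
      `|\sum_b lam b * (interaction om k a b - pr a b)| <= delta + 2 * eta].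
Proof.
move=> lm.
pose D b := a != b.
have cellE (c : {ffun V -> bool}) :
    [set om | forall b, D b -> X (edge k a b) om = c b]
    = [set om | forall b, b \in enum D -> X (edge k a b) om = c b].
  by apply/seteqP; split => om h b; have := h b; rewrite mem_enum.
have [|||||||||||Bad [mB PB hB]] := @chernoff R d Omega P V bool D true
    (fun b om => X (edge k a b) om) (fun b z => law a b z)
    (fun b z => z%:R - pr a b) lam eta delta.
- by move=> b z; exact: law_ge0.
- by move=> b _; rewrite big_bool /law /=; ring.
- move=> b _; rewrite big_bool /law /=; ring.
- move=> b z; have /andP[? ?] := pr01 a b; rewrite ler_norml.
  by case: z; apply/andP; split; rewrite /=; lra.
- by move=> c; rewrite cellE; exact: joint_measurable.
- move=> c; rewrite cellE -big_enum; apply: joint_le.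
  + rewrite map_inj_in_uniq ?enum_uniq// => b b' _.
    rewrite mem_enum => ab' /edge_inj[[_]//|[e _]].
    by move: ab'; rewrite unfold_in /D e eqxx.
  + by move=> b; rewrite mem_enum; exact: edge_free.
  + by move=> b; rewrite mem_enum => ab; rewrite edge_law.
- by [].
- by move=> b; apply: le_trans (mu_le b); exact: lm.
- exact: weight_total.
- by [].
- by [].
exists Bad; split => // om /hB h; rewrite (bigD1 a)//=.
rewrite (eq_bigl D); last by move=> b; rewrite /D eq_sym.
rewrite (eq_bigr (fun b => lam b * ((X (edge k a b) om)%:R - pr a b))); last first.
  by move=> b ab; rewrite /interaction (ab : a != b).
apply: le_trans (ler_normD _ _) _; rewrite addrC lerD//.
rewrite /interaction eqxx /= sub0r mulrN normrN normrM.
have /andP[? ?] := pr01 a a; rewrite [`|pr a a|]ger0_norm//.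
apply: (@le_trans _ _ (eta * 1)); last by move: eta_gt0; lra.
by apply: ler_pM => //; exact: le_trans (lm a) (mu_le a).
Qed.

(** For distinct [b] and [b'], the pairs of coefficients attached to the third
    vertices [a] use pairwise distinct edges, so they are independent as [a]
    varies; the two terms [a = b] and [a = b'] cost at most [eta] each. *)
Lemma codegree_concentrated k b b' : b != b' ->
  exists Bad : set Omega, [/\ measurable Bad, (P Bad <= tail%:E)%E &
    forall om, ~ Bad om ->
      `|\sum_a mu a * (interaction om k a b * interaction om k a b'
          - pr a b * pr a b')| <= delta + 2 * eta].
Proof.
move=> bb'.
pose D a := (a != b) && (a != b').
pose eds (j : V * bool) := edge k j.1 (if j.2 then b else b').
pose val (c : {ffun V -> bool * bool}) (j : V * bool) :=
  if j.2 then (c j.1).1 else (c j.1).2.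
have cellE (c : {ffun V -> bool * bool}) :
    [set om | forall a, D a -> (X (edge k a b) om, X (edge k a b') om) = c a]
    = [set om | forall j, j \in enum [pred j : V * bool | D j.1] ->
        X (eds j) om = val c j].
  apply/seteqP; split => om h.
    by case=> a x; rewrite mem_enum /= => /h; rewrite /eds /val /= => <-; case: x.
  move=> a Da; have h1 := h (a, true); have h2 := h (a, false).
  rewrite !mem_enum in h1 h2; have {}h1 := h1 Da; have {}h2 := h2 Da.
  by rewrite /eds /val /= in h1 h2; rewrite h1 h2; case: (c a).
have mu_norm a : `|mu a| = mu a by rewrite ger0_norm.
have sum_pairs (F : bool * bool -> R) : \sum_z F z =
    F (true, true) + F (true, false) + (F (false, true) + F (false, false)).
  transitivity (\sum_x \sum_y F (x, y)); last by rewrite !big_bool.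
  by rewrite pair_bigA; apply: eq_bigr => -[].
have [|||||||||||Bad [mB PB hB]] := @chernoff R d Omega P V (bool * bool)%type D
    (true, true) (fun a om => (X (edge k a b) om, X (edge k a b') om))
    (fun a z => law a b z.1 * law a b' z.2)
    (fun a z => (z.1 && z.2)%:R - pr a b * pr a b') mu eta delta.
- by move=> a z; rewrite mulr_ge0// law_ge0.
- by move=> a _; rewrite sum_pairs /law /=; ring.
- by move=> a _; rewrite sum_pairs /law /=; ring.
- move=> a z; have /andP[x0 x1] := pr01 a b; have /andP[y0 y1] := pr01 a b'.
  have xy0 := mulr_ge0 x0 y0; have xy1 := mulr_ile1 x0 y0 x1 y1.
  by rewrite ler_norml; case: (z.1 && z.2); apply/andP; split; rewrite /=; lra.
- by move=> c; rewrite cellE; exact: joint_measurable.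
- move=> c; rewrite cellE.
  rewrite (eq_bigr (fun a => \prod_(x : bool) law a (if x then b else b')
    (val c (a, x)))); last by move=> a _; rewrite big_bool.
  rewrite (pair_big D predT (fun a x => law a (if x then b else b') (val c (a, x)))) /=.
  rewrite (eq_bigl [pred j : V * bool | D j.1]); last by move=> j; rewrite /= andbT.
  rewrite -big_enum; apply: joint_le.
  + rewrite map_inj_in_uniq ?enum_uniq// => -[a x] [a' x'].
    rewrite !mem_enum !inE /eds /D /= => /andP[ab ab'] /andP[a'b a'b'].
    move=> /edge_inj[[-> e]|[e _]]; last first.
      by move: ab ab'; rewrite e; case: (x'); rewrite eqxx.
    by move: e bb'; case: (x) (x') => -[]// ->; rewrite eqxx.
  + move=> [a x]; rewrite mem_enum inE /eds /D /= => /andP[ab ab'].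
    by apply: edge_free; case: x.
  + move=> [a x]; rewrite mem_enum inE /eds /D /= => /andP[ab ab'].
    by rewrite edge_law//; case: x.
- by [].
- by move=> a; rewrite mu_norm.
- by apply: weight_total => a; rewrite mu_norm.
- by [].
- by [].
exists Bad; split => // om /hB h.
have edge_term a : a = b \/ a = b' ->
    `|mu a * (interaction om k a b * interaction om k a b' - pr a b * pr a b')|
     <= eta.
  move=> abb'; have -> : interaction om k a b * interaction om k a b' = 0.
    by case: abb' => ->; rewrite /interaction eqxx ?mul0r ?mulr0.
  have /andP[x0 x1] := pr01 a b; have /andP[y0 y1] := pr01 a b'.
  rewrite sub0r mulrN normrN normrM mu_norm ger0_norm ?mulr_ge0//.
  apply: le_trans (mu_le a); rewrite ler_piMr//; exact: mulr_ile1.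
rewrite (bigD1 b)//= (bigD1 b')/=; last by rewrite eq_sym.
rewrite (eq_bigr (fun a => mu a *
    ((X (edge k a b) om && X (edge k a b') om)%:R - pr a b * pr a b'))); last first.
  move=> a /andP[ab ab']; rewrite /interaction ab ab' /=.
  by rewrite -natrM mulnb.
apply: le_trans (ler_normD _ _) _.
have h1 := edge_term b (or_introl erefl).
have h2 := edge_term b' (or_intror erefl).
apply: (@le_trans _ _ (eta + (eta + delta))); last lra.
apply: lerD => //; apply: le_trans (ler_normD _ _) _; exact: lerD.
Qed.

(** Union bound over the times, and over the pairs vertex and group for degrees
    and the pairs of vertices for codegrees. *)
Lemma quasirandom_whp (K : nat) : exists A : set Omega, [/\ measurable A,
  ((1 - K%:R * (#|{: V}|%:R * 2 + #|{: V}|%:R ^+ 2) * tail)%:E <= P A)%E &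
  forall om, A om -> forall k, (k < K)%N ->
    quasirandom in_first mu p q (delta + 2 * eta) (interaction om k)].
Proof.
pose I := ('I_K * (V * bool + V * V))%type.
pose good om (i : I) : Prop := match i.2 with
  | inl (a, g) => `|\sum_(b | in_first b == g)
      mu b * (interaction om i.1 a b - pr a b)| <= delta + 2 * eta
  | inr (b, b') => b != b' -> `|\sum_a mu a * (interaction om i.1 a b *
      interaction om i.1 a b' - pr a b * pr a b')| <= delta + 2 * eta
  end.
have bad i : exists Bad : set Omega, [/\ measurable Bad, (P Bad <= tail%:E)%E &
    forall om, ~ Bad om -> good om i].
  case: i => k [[a g]|[b b']] /=.
    have lm b : `|(if in_first b == g then mu b else 0)| <= mu b.
      by case: ifP => _; rewrite ?ger0_norm// normr0.
    have [Bad [mB PB hB]] := degree_concentrated k a lm.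
    exists Bad; split => // om /hB h; rewrite /good /= big_mkcond /=.
    apply: le_trans h; rewrite le_eqVlt; apply/orP; left; apply/eqP.
    by congr (`|_|); apply: eq_bigr => b _; case: ifP => _; rewrite ?mul0r.
  have [<-|bb'] := eqVneq b b'.
    by exists set0; split; rewrite /good ?measure0 ?lee_fin ?mulr_ge0 ?expR_ge0//= eqxx.
  have [Bad [mB PB hB]] := codegree_concentrated k bb'.
  by exists Bad; split => // om /hB h _.
have [F HF] := choice bad.
pose U := \big[setU/set0]_(i : I) F i.
have mU : measurable U by apply: bigsetU_measurable => i _; have [] := HF i.
exists (~` U); split; first exact: measurableC.
  rewrite probability_setC// EFinB leeB//.
  have mF i : measurable (F i) by have [] := HF i.
  have PF i : true -> (P (F i) <= tail%:E)%E by have [] := HF i.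
  apply: le_trans (union_bound (index_enum I) mF PF) _.
  rewrite lee_fin sumr_const -[leLHS]mulr_natl ler_wpM2r ?mulr_ge0 ?expR_ge0//.
  rewrite card_prod card_sum !card_prod card_bool card_ord.
  by rewrite natrM natrD !natrM expr2.
move=> om nU k kK.
have ok i : good om i.
  have [_ _] := HF i; apply => Fi; apply: nU.
  by rewrite /U (bigD1 i)//=; left.
split=> [a g|b b' bb'].
  exact: (ok (Ordinal kK, inl (a, g))).
exact: (ok (Ordinal kK, inr (b, b')) bb').
Qed.

End RandomArrays.

(** * Projection onto the initial separation direction *)

Section Dot.
Variables (R : realType) (dim : nat).
Implicit Types u v : 'rV[R]_dim.

Lemma dotZl a u v : dot (a *: u) v = a * dot u v.
Proof. by rewrite /dot mulr_sumr; apply: eq_bigr => c _; rewrite mxE mulrA. Qed.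

Lemma dotC u v : dot u v = dot v u.
Proof. by apply: eq_bigr => c _; rewrite mulrC. Qed.

Lemma dotBl u1 u2 v : dot (u1 - u2) v = dot u1 v - dot u2 v.
Proof. by rewrite /dot -sumrB; apply: eq_bigr => c _; rewrite !mxE mulrBl. Qed.

Lemma dot_suml (I : Type) (s : seq I) (Q : pred I) (F : I -> 'rV[R]_dim) v :
  dot (\sum_(i <- s | Q i) F i) v = \sum_(i <- s | Q i) dot (F i) v.
Proof.
rewrite /dot exchange_big /=; apply: eq_bigr => c _.
by rewrite summxE mulr_suml.
Qed.

Lemma dot_ge0 u : 0 <= dot u u.
Proof. by apply: sumr_ge0 => c _; rewrite -expr2 sqr_ge0. Qed.

Lemma enorm_sqr u : enorm u ^+ 2 = dot u u.
Proof. by rewrite sqr_sqrtr// dot_ge0. Qed.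

Lemma enorm_gt0 u : u != 0 -> 0 < enorm u.
Proof.
move=> u0; rewrite sqrtr_gt0 lt_neqAle dot_ge0 andbT eq_sym.
apply: contra u0 => /eqP d0; apply/eqP/rowP => c; rewrite mxE.
have pos i : predT i -> 0 <= u 0 i * u 0 i by rewrite -expr2 sqr_ge0.
by have /eqP := psumr_eq0P pos d0 (isT : predT c); rewrite mulf_eq0 orbb => /eqP.
Qed.

(** The orthogonal projection of [u] on the line of [v] is not longer than
    [u]. *)
Lemma dot_unit_le u v : enorm v = 1 -> dot u v ^+ 2 <= dot u u.
Proof.
move=> v1; have := dot_ge0 (u - dot u v *: v).
rewrite dotBl dotZl ![dot _ (u - _)]dotC !dotBl !dotZl (dotC v u).
by rewrite -(enorm_sqr v) v1; lra.
Qed.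

Lemma enorm_normalize u : u != 0 -> enorm ((enorm u)^-1 *: u) = 1.
Proof.
move=> u0; have e0 := enorm_gt0 u0.
rewrite {1}/enorm dotZl dotC dotZl -enorm_sqr.
by rewrite (_ : _ * _ = 1) ?sqrtr1//; field; rewrite lt0r_neq0.
Qed.

Variable tau : R.

Lemma is_derive_coord (x : R -> 'rV[R]_dim) (dx : 'rV[R]_dim) (t : R) c :
  is_derive t 1 x dx -> is_derive t 1 (fun s => x s 0 c) (dx 0 c).
Proof.
case=> dx1 <-; apply: DeriveDef; first exact: (derivable_mxP _ _ _).1.
by rewrite derive_mx// mxE.
Qed.

Lemma pw_derive_dot (x : R -> 'rV[R]_dim) (dx : nat -> R -> 'rV[R]_dim) v :
  {within `[0, +oo[, continuous x} ->
  (forall (k : nat) (t : R), k%:R * tau < t < k.+1%:R * tau ->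
    is_derive t 1 x (dx k t)) ->
  pw_derive tau (fun t => dot (x t) v) (fun k t => dot (dx k t) v).
Proof.
move=> cx dx1; apply: pw_derive_sum => c _.
have coord : pw_derive tau (fun t => x t 0 c) (fun k t => dx k t 0 c).
  split=> [t|k t kt]; last by apply: is_derive_coord; exact: dx1.
  exact: (continuous_comp (cx t) (@coord_continuous R 1 dim 0 c _)).
apply: (pw_derive_eq (pw_deriveZ (v 0 c) coord)) => [t|k t _];
  by rewrite /= mulrC.
Qed.

End Dot.

Section FiniteExtrema.
Variables (R : realType) (n : nat).
Hypothesis n_gt0 : (0 < n)%N.
Implicit Type f : 'I_n -> R.

Lemma fmax_attained f : exists i0, fmax f = f i0 /\ forall i, f i <= f i0.
Proof.
have [i0 _ hi] := @arg_maxP _ R 'I_n (Ordinal n_gt0) predT f isT.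
have ub i : f i <= f i0 by exact: hi.
exists i0; split=> //; apply/eqP; rewrite eq_le; apply/andP; split.
  by apply: ge_sup => [|_ [i _ <-]//]; exists (f i0), i0.
by apply: ub_le_sup; [exists (f i0) => _ [i _ <-]|exists i0].
Qed.

Lemma fmin_attained f : exists i0, fmin f = f i0 /\ forall i, f i0 <= f i.
Proof.
have [i0 _ hi] := @arg_minP _ R 'I_n (Ordinal n_gt0) predT f isT.
have lb i : f i0 <= f i by exact: hi.
exists i0; split=> //; apply/eqP; rewrite eq_le; apply/andP; split.
  by apply: ge_inf; [exists (f i0) => _ [i _ <-]|exists i0].
by apply: lb_le_inf => [|_ [i _ <-]//]; exists (f i0), i0.
Qed.

End FiniteExtrema.

Section ScalarReduction.
Variables (R : realType) (dim N1 N2 : nat) (tau L : R).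
Variables (cx : nat -> 'I_N1 -> 'I_N1 -> bool).
Variables (cy : nat -> 'I_N2 -> 'I_N2 -> bool).
Variables (cxy : nat -> 'I_N1 -> 'I_N2 -> bool).
Variables (x : 'I_N1 -> R -> 'rV[R]_dim) (y : 'I_N2 -> R -> 'rV[R]_dim).
Hypotheses (N1_gt0 : (0 < N1)%N) (N2_gt0 : (0 < N2)%N).
Hypothesis sol : solves tau cx cy cxy x y.

Let V := ('I_N1 + 'I_N2)%type.
Let mx := mean (fun i => x i 0).
Let my := mean (fun j => y j 0).

Hypothesis means_neq : mx <> my.

Definition group_weight (a : V) : R :=
  if a is inl _ then N1%:R^-1 else N2%:R^-1.

Definition coupling (k : nat) (a b : V) : R :=
  match a, b with
  | inl i, inl i' => ((i != i') && cx k i i')%:R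
  | inr j, inr j' => ((j != j') && cy k j j')%:R
  | inl i, inr j => (cxy k i j)%:R
  | inr j, inl i => (cxy k i j)%:R
  end.

Let gap := enorm (my - mx).

(** The final separating direction is already visible at time [0]: it points
    from the first mean to the second. *)
Definition direction : 'rV[R]_dim := gap^-1 *: (my - mx).

Definition midpoint : R := (dot mx direction + dot my direction) / 2.

(** Signed distance to the mid-hyperplane, in units of the initial gap and
    counted positively on the side where each group starts on average. With this
    sign both attraction and repulsion contribute nonnegative off-diagonal
    coefficients. *)
Definition signed_distance (a : V) (t : R) : R :=
  match a with
  | inl i => gap^-1 * (midpoint - dot (x i t) direction)
  | inr j => gap^-1 * (dot (y j t) direction - midpoint)
  end.

Definition initial_deviation (a : V) : R :=
  match a with
  | inl i => - (gap^-1 * dot (deviation (fun i => x i 0) i) direction)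
  | inr j => gap^-1 * dot (deviation (fun j => y j 0) j) direction
  end.

Lemma gap_gt0 : 0 < gap.
Proof. by apply: enorm_gt0; rewrite subr_eq0; apply/eqP => e; exact: means_neq. Qed.

Lemma direction_unit : enorm direction = 1.
Proof.
by apply: enorm_normalize; rewrite subr_eq0; apply/eqP => e; exact: means_neq.
Qed.

Lemma gap_dot : dot my direction - dot mx direction = gap.
Proof.
rewrite -dotBl dotC dotZl -enorm_sqr -/gap expr2 mulrA mulVf ?mul1r//.
by rewrite lt0r_neq0// gap_gt0.
Qed.

Lemma group_weight_ge0 a : 0 <= group_weight a.
Proof. by case: a => i; rewrite /= invr_ge0. Qed.

Lemma group_sum (F : V -> R) g :
  \sum_(b | in_first b == g) F b =
  if g then \sum_i F (inl i) else \sum_j F (inr j).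
Proof.
by case: g; rewrite big_sumType /= big_pred0_eq ?add0r ?addr0.
Qed.

Lemma group_weight1 g : \sum_(b | in_first b == g) group_weight b = 1.
Proof.
rewrite group_sum; case: g; rewrite sumr_const card_ord -[LHS]mulr_natl mulfV//;
  by rewrite pnatr_eq0 -lt0n.
Qed.

Lemma coupling01 k a b : 0 <= coupling k a b <= 1.
Proof. by case: a b => i [] j; rewrite /coupling ler0n lern1 leq_b1. Qed.

Lemma signed_distance_solution :
  signed_solution tau (@in_first N1 N2) group_weight coupling signed_distance.
Proof.
have [cx1 cy1 dxy] := sol.
case=> [i|j].
  have h := @pw_derive_dot _ _ tau _ _ direction (cx1 i)
    (fun k t kt => (dxy k t kt).1 i).
  have h1 := pw_deriveZ (gap^-1) (pw_deriveD (pw_derive_cst tau midpoint) (pw_deriveN h)).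
  apply: (pw_derive_eq h1) => // k t _ /=.
  rewrite add0r dotBl !dotZl !dot_suml big_sumType opprB mulrBr addrC -mulrN.
  rewrite !(big_mkcond (fun i' => i' != i)) /=.
  congr (_ + _); last first.
    rewrite !mulr_sumr; apply: eq_bigr => b _.
    by rewrite /sg /= dotZl dotBl; ring.
  rewrite -mulrN -sumrN !mulr_sumr; apply: eq_bigr => b _.
  by rewrite /sg /= eq_sym dotZl dotBl; case: eqP => _ /=; ring.
have h := @pw_derive_dot _ _ tau _ _ direction (cy1 j)
  (fun k t kt => (dxy k t kt).2 j).
have h1 := pw_deriveZ (gap^-1) (pw_deriveD h (pw_derive_cst tau (- midpoint))).
apply: (pw_derive_eq h1) => // k t _ /=.
rewrite addr0 dotBl !dotZl !dot_suml big_sumType mulrBr addrC -mulrN.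
rewrite !(big_mkcond (fun j' => j' != j)) /=.
congr (_ + _).
  rewrite -mulrN -sumrN !mulr_sumr; apply: eq_bigr => b _.
  by rewrite /sg /= dotZl dotBl; ring.
rewrite !mulr_sumr; apply: eq_bigr => b _.
by rewrite /sg /= eq_sym dotZl dotBl; case: eqP => _ /=; ring.
Qed.

Lemma signed_distance0 a : signed_distance a 0 = 1 / 2 + initial_deviation a.
Proof.
have g0 := lt0r_neq0 gap_gt0.
case: a => i; rewrite /signed_distance /initial_deviation /deviation dotBl
  /midpoint -/mx -/my; have h := gap_dot;
  rewrite (_ : dot my direction = dot mx direction + gap); by [field|lra].
Qed.

Lemma deviation_sum n (z : 'I_n -> 'rV[R]_dim) :
  (0 < n)%N -> \sum_i deviation z i = 0.
Proof.
move=> n0; rewrite /deviation sumrB sumr_const card_ord /mean.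
by rewrite -scaler_nat scalerA mulfV ?scale1r ?subrr// pnatr_eq0 -lt0n.
Qed.

Lemma initial_deviation_centred g :
  \sum_(b | in_first b == g) group_weight b * initial_deviation b = 0.
Proof.
rewrite group_sum; case: g; rewrite -mulr_sumr ?sumrN -mulr_sumr -dot_suml
  deviation_sum// -[0]subr0 dotBl subrr !(mulr0, oppr0)//.
Qed.

Hypothesis L_ge0 : 0 <= L.
Hypothesis spread :
  lambda_tilde (fun i => x i 0) (fun j => y j 0) <= L ^+ 2.

(** Projecting onto a unit vector does not increase the deviations, and the
    initial gap is the denominator of the spread. *)
Lemma initial_deviation_le a : `|initial_deviation a| <= L.
Proof.
have g0 := gap_gt0.
rewrite -(@ler_pXn2r _ 2)// ?nnegrE// real_normK ?num_real//.
have [i1 [e1 h1]] := fmax_attained N1_gt0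
  (fun i => enorm (deviation (fun i => x i 0) i) ^+ 2).
have [j1 [e2 h2]] := fmax_attained N2_gt0
  (fun j => enorm (deviation (fun j => y j 0) j) ^+ 2).
have : enorm (deviation (fun i => x i 0) i1) ^+ 2
     + enorm (deviation (fun j => y j 0) j1) ^+ 2 <= L ^+ 2 * gap ^+ 2.
  rewrite -ler_pdivrMr ?exprn_gt0//; move: spread.
  rewrite /lambda_tilde e1 e2 -/mx -/my (_ : enorm (mx - my) = gap)//.
  by rewrite /gap /enorm -opprB -scaleN1r dotZl dotC dotZl mulN1r mulN1r opprK.
have unit_le u : dot u u <= L ^+ 2 * gap ^+ 2 ->
    (gap^-1 * dot u direction) ^+ 2 <= L ^+ 2.
  move=> hu; rewrite exprMn exprVn mulrC ler_pdivrMr ?exprn_gt0//.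
  exact: le_trans (dot_unit_le _ direction_unit) hu.
have s1 := sqr_ge0 (enorm (deviation (fun i => x i 0) i1)).
have s2 := sqr_ge0 (enorm (deviation (fun j => y j 0) j1)).
move=> h; case: a => i; rewrite /initial_deviation ?sqrrN; apply: unit_le;
  rewrite -enorm_sqr.
  by have := h1 i; move: h s1 s2; lra.
by have := h2 i; move: h s1 s2; lra.
Qed.

Lemma separated_of_positive t : (forall a, 0 < signed_distance a t) ->
  fmax (fun i => dot (x i t) direction) < fmin (fun j => dot (y j t) direction).
Proof.
move=> pos; have g0 : 0 < gap^-1 by rewrite invr_gt0 gap_gt0.
have [i [-> _]] := fmax_attained N1_gt0 (fun i => dot (x i t) direction).
have [j [-> _]] := fmin_attained N2_gt0 (fun j => dot (y j t) direction).
have := pos (inl i); have := pos (inr j); rewrite /= !pmulr_rgt0//; lra.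
Qed.

End ScalarReduction.

(** The symmetry of the arrays inside the groups identifies a coefficient with
    the free coefficient of its edge. *)
Lemma coupling_interaction (R : realType) (d : measure_display)
    (Omega : measurableType d) (P : probability Omega R) (N1 N2 : nat) (p q : R)
    (psix : nat -> 'I_N1 -> 'I_N1 -> {RV P >-> bool})
    (psiy : nat -> 'I_N2 -> 'I_N2 -> {RV P >-> bool})
    (psixy : nat -> 'I_N1 -> 'I_N2 -> {RV P >-> bool}) (w : Omega) k a b :
  random_coefficients p q psix psiy psixy ->
  interaction psix psiy psixy w k a b =
  coupling R (fun k i i' => psix k i i' w) (fun k j j' => psiy k j j' w)
    (fun k i j => psixy k i j w) k a b.
Proof.
case=> -[sx sy] _ _ _ _.
case: a b => i [] j //=; rewrite /interaction /coupling /coef_family /edge /=.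
  rewrite (inj_eq inl_inj); case: ifP => _ //=; by rewrite sx.
rewrite (inj_eq inr_inj); case: ifP => _ //=; by rewrite sy.
Qed.

(** * Choice of the horizon and of the tolerance *)

Section Constants.
Variable R : realType.

Lemma quasirandom_weaken (V : finType) (grp : V -> bool) (mu : V -> R) p q d1 d2
    (psi : V -> V -> R) : d1 <= d2 ->
  quasirandom grp mu p q d1 psi -> quasirandom grp mu p q d2 psi.
Proof.
move=> d12 [h1 h2]; split=> [a g|b b' bb'].
  exact: le_trans (h1 a g) d12.
exact: le_trans (h2 b b' bb') d12.
Qed.

Lemma horizon_exists (nu tau a b : R) : 0 < nu -> 0 < tau -> 0 <= a -> 0 <= b ->
  exists2 K : nat, (0 < K)%N & a < expR (nu * (K%:R * tau)) /\
    b < expR (nu * (K%:R * tau)).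
Proof.
move=> nu0 tau0 a0 b0; pose z := (a + b) / (nu * tau).
have z0 : 0 <= z by rewrite divr_ge0 ?addr_ge0// ltW// mulr_gt0.
exists (Num.bound z).+1 => //.
have zK : z < (Num.bound z).+1%:R.
  by apply: lt_trans (archi_boundP z0) _; rewrite ltr_nat.
move: zK; rewrite /z ltr_pdivrMr ?mulr_gt0// => zK.
have := expR_ge1Dx (nu * ((Num.bound z).+1%:R * tau)).
rewrite [nu * (_ * tau)]mulrCA; move: zK; set X := _ * (nu * tau); set Y := expR _.
by move=> ? ?; split; lra.
Qed.

Lemma small_exists (nu A B : R) : 0 < nu -> 0 <= A -> 0 <= B ->
  exists2 delta : R, 0 < delta & [/\ delta <= 1, 4 * delta <= nu / 2,
    delta * A <= 1 / 2 & delta * B <= 1 / 8].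
Proof.
move=> nu0 A0 B0; pose S := 1 + 8 / nu + 2 * A + 8 * B.
have n0 : 0 < 8 / nu by rewrite divr_gt0.
have S0 : 0 < S by rewrite /S; lra.
exists S^-1; first by rewrite invr_gt0.
have small c z : 0 < c -> c * z <= S -> S^-1 * z <= c^-1.
  by move=> c0 cz; rewrite ler_pdivrMl// ler_pdivlMr// mulrC.
split.
- by rewrite -[S^-1]mulr1 -[leRHS]invr1; apply: small; rewrite /S; lra.
- have := small (8 / nu) 1 n0; rewrite mulr1 => /(_ _) h.
  have : S^-1 <= (8 / nu)^-1 by rewrite -[S^-1]mulr1; apply: h; rewrite /S; lra.
  rewrite invf_div; lra.
- by rewrite div1r; apply: small => //; rewrite /S; lra.
- by rewrite div1r; apply: small => //; rewrite /S; lra.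
Qed.

Lemma expRN_le_cube (z : R) : 0 < z -> expR (- z) <= 6 / z ^+ 3.
Proof.
move=> z0; rewrite expRN -invf_div lef_pV2 ?posrE ?expR_gt0 ?divr_gt0 ?exprn_gt0//.
by have := expR_ge1Dxn 2 (ltW z0); rewrite (_ : 3`!%:R = 6)//; lra.
Qed.

(** There are polynomially many events in the union bound, each of
    exponentially small probability. *)
Lemma failure_probability_small (K : nat) (kappa delta eps : R) :
  0 < kappa -> 0 < delta -> 0 < eps ->
  exists N0 : nat, forall (N : nat) (n : R), (0 < N)%N -> (N0 <= N)%N ->
    1 <= n -> n <= (1 + kappa) * N%:R ->
    N%:R^-1 <= delta /\
    K%:R * (n * 2 + n ^+ 2) * (2 * expR (- (delta ^+ 2 / (16 * N%:R^-1)))) <= eps.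
Proof.
move=> k0 d0 e0.
pose c := delta ^+ 2 / 16.
have c0 : 0 < c by rewrite divr_gt0// exprn_gt0.
pose Z := K%:R * 36 * (1 + kappa) ^+ 2 / c ^+ 3.
have Z0 : 0 <= Z.
  apply: divr_ge0; last by rewrite exprn_ge0// ltW.
  by rewrite mulr_ge0 ?sqr_ge0// mulr_ge0.
exists (maxn (Num.bound delta^-1) (Num.bound (Z / eps))) => N n N0.
rewrite geq_max => /andP[Nd Ne] n1 nN.
have NR : 0 < N%:R :> R by rewrite ltr0n.
have dN : delta^-1 <= N%:R.
  apply: ltW; apply: lt_le_trans (archi_boundP _) _; last by rewrite ler_nat.
  by rewrite invr_ge0 ltW.
have eN : Z / eps <= N%:R.
  apply: ltW; apply: lt_le_trans (archi_boundP _) _; last by rewrite ler_nat.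
  by rewrite divr_ge0// ltW.
split; first by rewrite -[delta]invrK lef_pV2 ?posrE ?invr_gt0.
have -> : delta ^+ 2 / (16 * N%:R^-1) = c * N%:R.
  by rewrite /c; field; rewrite lt0r_neq0.
have cN : 0 < c * N%:R by rewrite mulr_gt0.
apply: (@le_trans _ _ (K%:R * (3 * ((1 + kappa) * N%:R) ^+ 2) *
    (2 * (6 / (c * N%:R) ^+ 3)))).
  have n2 : n <= n ^+ 2 by rewrite expr2 ler_peMl//; lra.
  have nn : n ^+ 2 <= ((1 + kappa) * N%:R) ^+ 2.
    by rewrite ler_pXn2r ?nnegrE//; lra.
  apply: ler_pM.
  - by rewrite mulr_ge0//; lra.
  - by rewrite mulr_ge0 ?expR_ge0.
  - by rewrite ler_wpM2l//; lra.
  - by rewrite ler_pM2l// expRN_le_cube.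
rewrite (_ : _ * _ = Z / N%:R); last first.
  by rewrite /Z; field; rewrite !lt0r_neq0.
by rewrite ler_pdivrMr// mulrC -ler_pdivrMr.
Qed.

End Constants.

(** * Separation with large probability *)

Theorem theorem2p3 (R : realType) (p q tau kappa Lambda : R)
    (p_gt0 : 0 < p) (p_lt1 : p < 1) (q_gt0 : 0 < q) (q_lt1 : q < 1)
    (tau_gt0 : 0 < tau) (kappa_gt0 : 0 < kappa) (Lambda_gt0 : 0 < Lambda) :
  exists2 T : R, 0 < T &
  forall eps : R, 0 < eps ->
  exists N0 : nat,
  forall (dim N1 N2 : nat),
    (0 < N1)%N -> (0 < N2)%N -> (N0 <= minn N1 N2)%N ->
    kappa^-1 * N1%:R <= N2%:R -> N2%:R <= kappa * N1%:R ->
  forall (d : measure_display) (Omega : measurableType d)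
    (P : probability Omega R)
    (psix : nat -> 'I_N1 -> 'I_N1 -> {RV P >-> bool})
    (psiy : nat -> 'I_N2 -> 'I_N2 -> {RV P >-> bool})
    (psixy : nat -> 'I_N1 -> 'I_N2 -> {RV P >-> bool}),
    random_coefficients p q psix psiy psixy ->
  exists A : set Omega,
    [/\ measurable A,
        ((1 - eps)%:E <= P A)%E &
        forall w, A w ->
        forall (x : 'I_N1 -> R -> 'rV[R]_dim) (y : 'I_N2 -> R -> 'rV[R]_dim),
          solves tau (fun k i i' => psix k i i' w) (fun k j j' => psiy k j j' w)
            (fun k i j => psixy k i j w) x y ->
          mean (fun i => x i 0) <> mean (fun j => y j 0) ->
          lambda_tilde (fun i => x i 0) (fun j => y j 0) <= Lambda ->
          exists2 v : 'rV[R]_dim, enorm v = 1 &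
            forall t : R, T <= t ->
              fmax (fun i => dot (x i t) v) < fmin (fun j => dot (y j t) v)].
Proof.
(* Any [L] with [Lambda <= L ^+ 2] bounds the projected deviations. *)
pose L := 1 + Lambda.
have L_ge0 : 0 <= L by rewrite /L; lra.
have Lambda_L : Lambda <= L ^+ 2.
  by have := sqr_ge0 Lambda; rewrite /L; lra.
pose nu := p + q; have nu_gt0 : 0 < nu by rewrite addr_gt0.
pose C := 2 / nu ^+ 2 * (2 * L + 1) ^+ 2.
have C_ge0 : 0 <= C by rewrite mulr_ge0 ?divr_ge0 ?sqr_ge0.
have L4 : 0 <= 4 * L by rewrite mulr_ge0.
have C16 : 0 <= 16 * C by rewrite mulr_ge0.
have [K K_gt0 [M_L M_C]] := horizon_exists nu_gt0 tau_gt0 L4 C16.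
pose T := K%:R * tau; have T_gt0 : 0 < T by rewrite mulr_gt0// ltr0n.
pose M := expR (nu * T).
have A_ge0 : 0 <= M + 2 * L by rewrite addr_ge0 ?expR_ge0 ?mulr_ge0.
have B_ge0 : 0 <= (6 * M ^+ 2 + 48 * L ^+ 2) * expR (9 * T).
  by rewrite mulr_ge0 ?expR_ge0// addr_ge0// mulr_ge0 ?sqr_ge0.
have [delta delta_gt0 [delta_le1 delta_nu delta_sup delta_energy]] :=
  small_exists nu_gt0 A_ge0 B_ge0.
exists T => // eps eps_gt0.
(* Concentration is used with tolerance [delta / 4]; the diagonal terms cost
   [2 / N <= delta / 2] more. *)
have delta4_gt0 : 0 < delta / 4 by rewrite divr_gt0.
have [N0 HN0] := failure_probability_small K kappa_gt0 delta4_gt0 eps_gt0.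
exists N0 => dim N1 N2 N1_gt0 N2_gt0 N0_le kappa1 kappa2 d Omega P psix psiy psixy rand.
pose N := minn N1 N2.
have N_gt0 : (0 < N)%N by rewrite leq_min N1_gt0.
have NR : 0 < N%:R :> R by rewrite ltr0n.
pose V := ('I_N1 + 'I_N2)%type.
pose mu : V -> R := @group_weight R N1 N2.
have mu_ge0 : forall a, 0 <= mu a := @group_weight_ge0 R N1 N2.
have mu1 := @group_weight1 R N1 N2 N1_gt0 N2_gt0.
have mu2 : \sum_a mu a = 2 := mu_total mu1 (inl (Ordinal N1_gt0)).
have mu_le a : mu a <= N%:R^-1.
  by case: a => i; rewrite /mu /= lef_pV2 ?posrE ?ltr0n// ler_nat ?geq_minl ?geq_minr.
have cardV : #|{: V}|%:R = N1%:R + N2%:R :> R.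
  by rewrite card_sum !card_ord natrD.
have N1_le : N1%:R <= kappa * N2%:R by rewrite -ler_pdivrMl.
have card_ge1 : 1 <= #|{: V}|%:R :> R.
  by rewrite cardV -natrD ler1n addn_gt0 N1_gt0.
have card_le : #|{: V}|%:R <= (1 + kappa) * N%:R.
  by rewrite cardV /N /minn; case: ifP => _; lra.
have [N_inv fail] := HN0 N _ N_gt0 N0_le card_ge1 card_le.
have p01 : 0 <= p <= 1 by rewrite !ltW.
have q01 : 0 <= q <= 1 by rewrite !ltW.
have eta_gt0 : 0 < N%:R^-1 :> R by rewrite invr_gt0.
have delta4_le4 : delta / 4 <= 4 by lra.
have mu2_le : \sum_a mu a <= 2 by rewrite mu2.
have [A [mA PA HA]] := quasirandom_whp p01 q01 rand mu_ge0 mu_le mu2_le eta_gt0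
  delta4_gt0 delta4_le4 K.
exists A; split => //.
  by apply: le_trans PA; rewrite lee_fin lerD2l lerN2.
move=> w Aw x y sol means_neq spread.
pose cx k i i' := psix k i i' w; pose cy k j j' := psiy k j j' w.
pose cxy k i j := psixy k i j w.
exists (direction x y); first exact: direction_unit.
move=> t Tt; apply: separated_of_positive => //.
have wsol := signed_distance_solution sol.
have psi01 := @coupling01 R N1 N2 cx cy cxy.
(* Later times are deterministic; only the first [K] steps are random. *)
apply: (positive_forever tau_gt0 mu_ge0 psi01 wsol (ltW T_gt0) Tt).
have qr k : (k < K)%N ->
    quasirandom (@in_first N1 N2) mu p q delta (coupling R cx cy cxy k).
  move=> /(HA w Aw k).
  rewrite (_ : interaction psix psiy psixy w k = coupling R cx cy cxy k); last first.
    by apply/funext => a; apply/funext => b; exact: coupling_interaction rand.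
  by apply: quasirandom_weaken; lra.
have rL : forall a, `|initial_deviation x y a| <= L.
  by apply: initial_deviation_le => //; exact: le_trans spread Lambda_L.
apply: (@positive_at_horizon R tau V (@in_first N1 N2) mu
  (coupling R cx cy cxy) (signed_distance x y) p q L delta
  (initial_deviation x y) K) => //.
- exact: signed_distance0.
- exact: ltW.
- by move: delta_sup; rewrite -/T -/M; lra.
- by rewrite -mulrA.
- by move=> k a kK; apply: (quasirandom_cross_degree mu1 (qr k kK)).
- by move=> k a kK; apply: (quasirandom_net_degree mu1 (qr k kK)).
- move=> k kK; apply: (quasirandom_quadratic_form mu_ge0 mu1 (qr k kK)) => //.
  + by move=> b; apply: le_trans (mu_le b) _; move: N_inv; lra.
  + exact: initial_deviation_centred.
Qed.
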